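(* For every $n\ge1$, the functor $\Psi_n:\mathfrak{q}\text{-}\mathbf{Web}_{\uparrow}\to\mathfrak{q}(n)\text{-}\mathbf{Mod}_{\mathcal S}$ is full.
   Context: **Conventions.** The ground field is $\mathbb{C}$. A supercategory is a category enriched in superspaces ($\mathbb Z_2$-graded vector spaces). In a monoidal supercategory $(f\otimes g)\circ(h\otimes k)=(-1)^{|g||h|}(f\circ h)\otimes(g\circ k)$. **Upward webs.** $\mathfrak{q}\text{-}\mathbf{Web}_{\uparrow}$ is the strict monoidal supercategory with generating objects $\uparrow_k$ ($k\ge 0$; $\uparrow_0$ is identified with the unit object) and generating morphisms, for $k,l\ge1$: the odd dot $d_k:\uparrow_k\to\uparrow_k$, the even merge $m_{k,l}:\uparrow_k\uparrow_l\to\uparrow_{k+l}$, the even split $s_{k,l}:\uparrow_{k+l}\to\uparrow_k\uparrow_l$. Edges labelled $0$ are omitted (so $m_{k,0},m_{0,k},s_{k,0},s_{0,k}$ are identities, $d_0=0$), and a composite involving a negative label is $0$. Write $1_k$ for the identity of $\uparrow_k$. On $\uparrow_k\uparrow_l$ define ladders $E^{(j)}=(m_{k,j}\otimes 1_{l-j})(1_k\otimes s_{j,l-j})$, $F^{(j)}=(1_{k-j}\otimes m_{j,l})(s_{k-j,j}\otimes 1_l)$, $E=E^{(1)}$, $F=F^{(1)}$, and dotted ladders $\bar E=(m_{k,1}\otimes 1_{l-1})(1_k\otimes d_1\otimes 1_{l-1})(1_k\otimes s_{1,l-1})$, $\bar F=(1_{k-1}\otimes m_{1,l})(1_{k-1}\otimes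 d_1\otimes 1_l)(s_{k-1,1}\otimes 1_l)$. On three strands $\uparrow_h\uparrow_k\uparrow_l$, a subscript $1$ (resp. $2$) means that the ladder is applied to the first two (resp. last two) strands. Relations, for all labels: (1) associativity $m_{h+k,l}(m_{h,k}\otimes1_l)=m_{h,k+l}(1_h\otimes m_{k,l})$ and $(s_{h,k}\otimes1_l)s_{h+k,l}=(1_h\otimes s_{k,l})s_{h,k+l}$; (2) $m_{k,l}s_{k,l}=\binom{k+l}{l}1_{k+l}$; (3) $d_k^2=k\,1_k$; (4) $d_{k+l}m_{k,l}=m_{k,l}(d_k\otimes1_l+1_k\otimes d_l)$, $s_{k,l}d_{k+l}=(d_k\otimes1_l+1_k\otimes d_l)s_{k,l}$; (5) $s_{1,1}m_{1,1}-(d_1\otimes d_1)s_{1,1}m_{1,1}(d_1\otimes d_1)=2\cdot 1_1\otimes1_1$; (6) $EF-FE=(k-l)\,1_k\otimes1_l$ on $\uparrow_k\uparrow_l$; (7) $\bar EF-F\bar E=d_k\otimes1_l-1_k\otimes d_l=E\bar F-\bar FE$ on $\uparrow_k\uparrow_l$; (8) $E_1E_2-E_2E_1=\bar E_1\bar E_2+\bar E_2\bar E_1$, $F_2F_1-F_1F_2=\bar F_1\bar F_2+\bar F_2\bar F_1$; (9) $E_1\bar E_2-\bar E_2E_1=\bar E_1E_2-E_2\bar E_1$, $F_1\bar F_2-\bar F_2F_1=\bar F_1F_2-F_2\bar F_1$. **Modules.** $V_n$ is the superspace with even basis $v_1,\dots,v_n$ and odd basis $v_{\bar1},\dots,v_{\bar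 n}$; $c:V_n\to V_n$ is the odd map $c(v_i)=(-1)^{|v_i|}\sqrt{-1}\,v_{\bar i}$ ($\bar{\bar i}=i$). $\mathfrak{q}(n)=\{x\in\mathfrak{gl}(V_n): [x,c]=0\}$ (graded commutators). Morphisms of $\mathfrak q(n)$-supermodules are all (not only even) homomorphisms, homogeneous ones satisfying $f(x.v)=(-1)^{|f||x|}x.f(v)$. $S^k(V_n)$ is the $k$th supersymmetric power, $S^0(V_n)=\mathbb{C}$. $\mathfrak{q}(n)\text{-}\mathbf{Mod}_{\mathcal{S}}$ is the full monoidal subcategory of $\mathfrak q(n)$-supermodules on finite tensor products of the $S^p(V_n)$, $p\ge0$. **The functor.** $\Psi_n$ is the monoidal superfunctor with $\uparrow_k\mapsto S^k(V_n)$; $d_k\mapsto\big(v_1\cdots v_k\mapsto\sum_t(-1)^{|v_1|+\dots+|v_{t-1}|}v_1\cdots c(v_t)\cdots v_k\big)$; $m_{k,l}\mapsto$ multiplication; $s_{k,l}\mapsto\big(v_1\cdots v_{k+l}\mapsto\sum(-1)^{\varepsilon_{I,J}}v_{i_1}\cdots v_{i_k}\otimes v_{j_1}\cdots v_{j_l}\big)$, the sum over all $I=\{i_1<\dots<i_k\}$, $J=\{j_1<\dots<j_l\}$ with $I\sqcup J=\{1,\dots,k+l\}$, where $v_{i_1}\cdots v_{i_k}v_{j_1}\cdots v_{j_l}=(-1)^{\varepsilon_{I,J}}v_1\cdots v_{k+l}$. *)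

(* Defs.v *)
From HB Require Import structures.
From mathcomp Require Import all_boot all_order all_algebra.
From mathcomp Require Import reals.
From mathcomp.real_closed Require Export complex.
Set Implicit Arguments.
Unset Strict Implicit.
Unset Printing Implicit Defensive.
Import GRing.Theory Num.Theory.
Local Open Scope ring_scope.

(* The ground field is a parameter C : numClosedFieldType of the definitions;
   it is the field of complex numbers R[i], R : realType, in the theorem. *)

(** * Finite-dimensional superspaces and linear maps

   A superspace is given by a finite homogeneous basis together with the parity
   of the basis vectors (true = odd).  A linear map f : M -> N is given by its
   matrix: f (y, x) is the coefficient of the basis vector y of N in f(x). *)

Record superspace := Superspace {
  sbase :> finType;
  spar : sbase -> bool }.

Section Superspaces.
Variable C : numClosedFieldType.
Implicit Types M N P : superspace.

Definition svec M : Type := {ffun M -> C^o}.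
Definition shom M N : Type := {ffun N * M -> C^o}.

Definition sapp M N (f : shom M N) (v : svec M) : svec N :=
  [ffun y => \sum_(x : M) f (y, x) * v x].

Definition sid M : shom M M := [ffun p => (p.1 == p.2)%:R].

Definition scomp M N P (g : shom N P) (f : shom M N) : shom M P :=
  [ffun p => \sum_(y : N) g (p.1, y) * f (y, p.2)].

Definition hpart (e : bool) M N (f : shom M N) : shom M N :=
  [ffun p => if spar p.1 (+) spar p.2 == e then f p else 0].

Definition homog (e : bool) M N (f : shom M N) : Prop := hpart e f = f.

Definition sunit : superspace := @Superspace unit (fun=> false).

Definition stens M N : superspace :=
  @Superspace (M * N)%type (fun p => spar p.1 (+) spar p.2).

(* (f \otimes g)(u \otimes v) = (-1)^(|g||u|) f(u) \otimes g(v); the entry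
   g (y, x) belongs to the component of g of parity |y| + |x|. *)
Definition stensm M N M' N' (f : shom M N) (g : shom M' N') :
    shom (stens M M') (stens N N') :=
  [ffun p => (-1) ^+ ((spar p.1.2 (+) spar p.2.2) && spar p.2.1)
             * (f (p.1.1, p.2.1) * g (p.1.2, p.2.2))].

Definition sbracket M (x y : shom M M) : shom M M :=
  \sum_(e : bool) \sum_(e' : bool)
    (scomp (hpart e x) (hpart e' y)
     - (-1 : C) ^+ (e && e') *: scomp (hpart e' y) (hpart e x)).

End Superspaces.

(** * The superspace V_n and its supersymmetric powers *)

(* (i, false) is the even vector v_(i+1), (i, true) the odd one v_(bar(i+1)). *)
Definition letter (n : nat) : finType := ('I_n * bool)%type.

Definition Vn (n : nat) : superspace := @Superspace (letter n) (fun l => l.2).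

Definition bar n (l : letter n) : letter n := (l.1, ~~ l.2).

Definition wpar n (w : seq (letter n)) : bool := odd (count snd w).

(* The basis of S^k(V_n): products v_(l_1) ... v_(l_k) weakly increasing for
   v_1 < ... < v_n < v_(bar 1) < ... < v_(bar n), without repetition of an odd
   letter. *)
Definition lrank n (l : letter n) : nat := l.2 * n + l.1.

Definition mrel n : rel (letter n) :=
  fun l l' => (lrank l < lrank l')%N || ((l == l') && ~~ l.2).

Definition mon (n k : nat) : finType :=
  {w : k.-tuple (letter n) | sorted (@mrel n) w}.

Definition Sym (n k : nat) : superspace :=
  @Superspace (mon n k) (fun m => wpar (val m)).

(* S^(a_1)(V_n) \otimes ... \otimes S^(a_r)(V_n) *)
Fixpoint Sob (n : nat) (a : seq nat) : superspace :=
  if a is k :: a' then stens (Sym n k) (Sob n a') else sunit.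

(* The identification of S^(a ++ a') with S^a \otimes S^a', on bases. *)
Fixpoint lsplit n (a a' : seq nat) : Sob n (a ++ a') -> Sob n a :=
  match a return Sob n (a ++ a') -> Sob n a with
  | [::] => fun=> tt
  | k :: a1 => fun p => (p.1, @lsplit n a1 a' p.2)
  end.

Fixpoint rsplit n (a a' : seq nat) : Sob n (a ++ a') -> Sob n a' :=
  match a return Sob n (a ++ a') -> Sob n a' with
  | [::] => id
  | k :: a1 => fun p => @rsplit n a1 a' p.2
  end.

(* Sign exponent of the reordering of a word into increasing order: the number
   of inversions between odd letters. *)
Fixpoint winv n (w : seq (letter n)) : nat :=
  if w is l :: w' then
    (count (fun l' : letter n => [&& l.2, l'.2 & (l'.1 < l.1)%N]) w' + winv w')%N
  else 0%N.

Section Modules.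
Variables (C : numClosedFieldType) (n : nat).
Local Notation letter := (letter n).

(* The product v_(l_1) ... v_(l_k) in S^k(V_n) of the letters of a word of
   length k.  If an odd letter is repeated, no basis element is a permutation
   of the word and the product is 0. *)
Definition symw (k : nat) (w : seq letter) : svec C (Sym n k) :=
  [ffun m : mon n k => if perm_eq (val m) w then (-1) ^+ winv w else 0].

(* The pure tensor of the products of the words of a list. *)
Fixpoint pure (a : seq nat) (ws : seq (seq letter)) : svec C (Sob n a) :=
  match a return svec C (Sob n a) with
  | [::] => [ffun=> 1]
  | k :: a' => [ffun p : Sym n k * Sob n a' =>
                 symw k (head [::] ws) p.1 * pure a' (behead ws) p.2]
  end.

Definition stenso (a b a' b' : seq nat)
    (f : shom C (Sob n a) (Sob n b)) (g : shom C (Sob n a') (Sob n b')) :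
    shom C (Sob n (a ++ a')) (Sob n (b ++ b')) :=
  [ffun p => stensm f g ((lsplit p.1, rsplit p.1), (lsplit p.2, rsplit p.2))].

Definition gl : Type := shom C (Vn n) (Vn n).

(* c(v_l) = (-1)^|l| sqrt(-1) v_(bar l) *)
Definition cV : gl :=
  [ffun p : letter * letter =>
     if p.1 == bar p.2 then (-1) ^+ p.2.2 * 'i else 0].

Definition q_mem (x : gl) : Prop := sbracket x cV = 0.

(* sum_t (-1)^(|x| (|w_1| + ... + |w_(t-1)|)) w_1 ... x(w_t) ... w_k; as above,
   |x| is the parity |l| + |w_t| of the matrix entry of x that is involved. *)
Definition derw (k : nat) (x : gl) (w : k.-tuple letter) : svec C (Sym n k) :=
  \sum_(t < k) \sum_(l : letter)
    ((-1) ^+ ((l.2 (+) (tnth w t).2) && wpar (take t w)) * x (l, tnth w t))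
      *: symw k (set_nth l w t l).

Definition act_Sym (k : nat) (x : gl) : shom C (Sym n k) (Sym n k) :=
  [ffun p : mon n k * mon n k => derw x (val p.2) p.1].

(* x.(u \otimes v) = x.u \otimes v + (-1)^(|x||u|) u \otimes x.v *)
Fixpoint act (a : seq nat) (x : gl) : shom C (Sob n a) (Sob n a) :=
  match a return shom C (Sob n a) (Sob n a) with
  | [::] => 0
  | k :: a' => stensm (act_Sym k x) (sid C (Sob n a'))
               + stensm (sid C (Sym n k)) (act a' x)
  end.

(* The morphisms S^a -> S^b of q(n)-Mod_S: sums of an even and of an odd
   homomorphism. *)
Definition qhom (a b : seq nat) (f : shom C (Sob n a) (Sob n b)) : Prop :=
  forall (e e' : bool) (x : gl), q_mem x -> homog e' x ->
    scomp (hpart e f) (act a x)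
    = (-1 : C) ^+ (e && e') *: scomp (act b x) (hpart e f).

End Modules.

(** * The monoidal supercategory q-Web_up

   Objects are words in the strands of positive thickness, since the strand of
   thickness 0 is the unit object.  Morphisms a -> b are represented by terms t
   with [typed a b t], and [weq a b] is their equality; [Tcomp t u] is t after
   u. *)

Definition wobj (a : seq nat) : bool := 0%N \notin a.

Definition up (k : nat) : seq nat := if k is 0%N then [::] else [:: k].

Inductive term (C : Type) : Type :=
| Tid of seq nat
| Tdot of nat
| Tmerge of nat & nat
| Tsplit of nat & nat
| Tcomp of term C & term C
| Ttens of term C & term C
| Tzero of seq nat & seq nat
| Tadd of term C & term C
| Tscale of C & term C.

Arguments Tid {C} _.
Arguments Tdot {C} _.
Arguments Tmerge {C} _ _.
Arguments Tsplit {C} _ _.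
Arguments Tzero {C} _ _.

Declare Scope web_scope.
Delimit Scope web_scope with W.
Bind Scope web_scope with term.
Notation "t \oc u" := (Tcomp t u)
  (at level 45, right associativity) : web_scope.
Notation "t \ox u" := (Ttens t u)
  (at level 40, left associativity) : web_scope.
Notation "t + u" := (Tadd t u) : web_scope.
Notation "z *: t" := (Tscale z t) : web_scope.
Notation "t - u" := (Tadd t (Tscale (-1)%R u)) : web_scope.

Section Web.
Variable C : numClosedFieldType.
Local Notation term := (term C).
Local Open Scope web_scope.
Implicit Types (a b c d : seq nat) (t u v w : term) (h k l : nat).
Local Notation Tid := (@Tid C).
Local Notation Tzero := (@Tzero C).

Inductive typed : seq nat -> seq nat -> term -> Prop :=
| ty_id a : wobj a -> typed a a (Tid a)
| ty_dot k : (0 < k)%N -> typed [:: k] [:: k] (Tdot k)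
| ty_merge k l : (0 < k)%N -> (0 < l)%N ->
    typed [:: k; l] [:: (k + l)%N] (Tmerge k l)
| ty_split k l : (0 < k)%N -> (0 < l)%N ->
    typed [:: (k + l)%N] [:: k; l] (Tsplit k l)
| ty_comp a b c t u : typed b c t -> typed a b u -> typed a c (t \oc u)
| ty_tens a b c d t u :
    typed a b t -> typed c d u -> typed (a ++ c) (b ++ d) (t \ox u)
| ty_zero a b : wobj a -> wobj b -> typed a b (Tzero a b)
| ty_add a b t u : typed a b t -> typed a b u -> typed a b (t + u)
| ty_scale a b z t : typed a b t -> typed a b (z *: t).

(* [tpar e t]: t is homogeneous of parity e. *)
Inductive tpar : bool -> term -> Prop :=
| par_id a : tpar false (Tid a)
| par_dot k : tpar true (Tdot k)
| par_merge k l : tpar false (Tmerge k l)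
| par_split k l : tpar false (Tsplit k l)
| par_comp e e' t u : tpar e t -> tpar e' u -> tpar (e (+) e') (t \oc u)
| par_tens e e' t u : tpar e t -> tpar e' u -> tpar (e (+) e') (t \ox u)
| par_zero e a b : tpar e (Tzero a b)
| par_add e t u : tpar e t -> tpar e u -> tpar e (t + u)
| par_scale e z t : tpar e t -> tpar e (z *: t).

(* The generators with edges labelled 0 allowed. *)
Definition idk k : term := Tid (up k).
Definition dotk k : term := if k == 0%N then Tzero [::] [::] else Tdot k.
Definition mergek k l : term :=
  if k == 0%N then idk l else if l == 0%N then idk k else Tmerge k l.
Definition splitk k l : term :=
  if k == 0%N then idk l else if l == 0%N then idk k else Tsplit k l.

(* Ladders on the strands k, l: those of type E require j <= l (resp. 1 <= l),
   those of type F require j <= k (resp. 1 <= k). *)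
Definition Elad j k l : term :=
  (mergek k j \ox idk (l - j)) \oc (idk k \ox splitk j (l - j)).
Definition Flad j k l : term :=
  (idk (k - j) \ox mergek j l) \oc (splitk (k - j) j \ox idk l).
Definition ladE := Elad 1.
Definition ladF := Flad 1.
Definition ladEd k l : term :=
  (mergek k 1 \ox idk (l - 1)) \oc (idk k \ox dotk 1 \ox idk (l - 1))
    \oc (idk k \ox splitk 1 (l - 1)).
Definition ladFd k l : term :=
  (idk (k - 1) \ox mergek 1 l) \oc (idk (k - 1) \ox dotk 1 \ox idk l)
    \oc (splitk (k - 1) 1 \ox idk l).

(* A composite involving a negative label, i.e. one for which the condition p
   fails, is 0. *)
Definition guard (p : bool) a b t : term := if p then t else Tzero a b.

(* X Y on the strands k, l, for X of type E and Y of type F, and conversely. *)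
Definition EFcomp (X Y : nat -> nat -> term) k l : term :=
  guard (0 < k)%N (up k ++ up l) (up k ++ up l) (X k.-1 l.+1 \oc Y k l).
Definition FEcomp (X Y : nat -> nat -> term) k l : term :=
  guard (0 < l)%N (up k ++ up l) (up k ++ up l) (X k.+1 l.-1 \oc Y k l).

Definition on1 (X : nat -> nat -> term) h k l : term := X h k \ox idk l.
Definition on2 (X : nat -> nat -> term) h k l : term := idk h \ox X k l.

(* X_1 Y_2 and X_2 Y_1 on the strands h, k, l, for X and Y of type E; the target
   h+1, k, l-1 exists for 0 < l. *)
Definition E12 (X Y : nat -> nat -> term) h k l : term :=
  on1 X h k.+1 l.-1 \oc on2 Y h k l.
Definition E21 (X Y : nat -> nat -> term) h k l : term :=
  guard (0 < k)%N (up h ++ up k ++ up l) (up h.+1 ++ up k ++ up l.-1)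
    (on2 X h.+1 k.-1 l \oc on1 Y h k l).

(* The same for X and Y of type F; the target h-1, k, l+1 exists for 0 < h. *)
Definition F21 (X Y : nat -> nat -> term) h k l : term :=
  on2 X h.-1 k.+1 l \oc on1 Y h k l.
Definition F12 (X Y : nat -> nat -> term) h k l : term :=
  guard (0 < k)%N (up h ++ up k ++ up l) (up h.-1 ++ up k ++ up l.+1)
    (on1 X h k.-1 l.+1 \oc on2 Y h k l).

Inductive web_rel : term -> term -> Prop :=
| rel_assoc_merge h k l :
    web_rel (mergek (h + k) l \oc (mergek h k \ox idk l))
            (mergek h (k + l) \oc (idk h \ox mergek k l))
| rel_assoc_split h k l :
    web_rel ((splitk h k \ox idk l) \oc splitk (h + k) l)
            ((idk h \ox splitk k l) \oc splitk h (k + l))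
| rel_digon k l :
    web_rel (mergek k l \oc splitk k l) ('C(k + l, l)%:R%R *: idk (k + l))
| rel_dot k : web_rel (dotk k \oc dotk k) (k%:R%R *: idk k)
| rel_dot_merge k l :
    web_rel (dotk (k + l) \oc mergek k l)
            (mergek k l \oc (dotk k \ox idk l + idk k \ox dotk l))
| rel_dot_split k l :
    web_rel (splitk k l \oc dotk (k + l))
            ((dotk k \ox idk l + idk k \ox dotk l) \oc splitk k l)
| rel_square :
    web_rel ((splitk 1 1 \oc mergek 1 1)
             - ((dotk 1 \ox dotk 1) \oc splitk 1 1 \oc mergek 1 1
                  \oc (dotk 1 \ox dotk 1)))
            (2%:R%R *: (idk 1 \ox idk 1))
| rel_EF k l :
    web_rel (EFcomp ladE ladF k l - FEcomp ladF ladE k l)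
            ((k%:R - l%:R)%R *: (idk k \ox idk l))
| rel_EdF k l :
    web_rel (EFcomp ladEd ladF k l - FEcomp ladF ladEd k l)
            (dotk k \ox idk l - idk k \ox dotk l)
| rel_EFd k l :
    web_rel (dotk k \ox idk l - idk k \ox dotk l)
            (EFcomp ladE ladFd k l - FEcomp ladFd ladE k l)
| rel_EE h k l : (0 < l)%N ->
    web_rel (E12 ladE ladE h k l - E21 ladE ladE h k l)
            (E12 ladEd ladEd h k l + E21 ladEd ladEd h k l)
| rel_FF h k l : (0 < h)%N ->
    web_rel (F21 ladF ladF h k l - F12 ladF ladF h k l)
            (F12 ladFd ladFd h k l + F21 ladFd ladFd h k l)
| rel_EEd h k l : (0 < l)%N ->
    web_rel (E12 ladE ladEd h k l - E21 ladEd ladE h k l)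
            (E12 ladEd ladE h k l - E21 ladE ladEd h k l)
| rel_FFd h k l : (0 < h)%N ->
    web_rel (F12 ladF ladFd h k l - F21 ladFd ladF h k l)
            (F12 ladFd ladF h k l - F21 ladF ladFd h k l).

(* The axioms of strict monoidal supercategories. *)
Inductive smc_rel : term -> term -> Prop :=
| smc_addA t u v : smc_rel (t + (u + v)) ((t + u) + v)
| smc_addC t u : smc_rel (t + u) (u + t)
| smc_add0 a b t : smc_rel (Tzero a b + t) t
| smc_subr a b t : smc_rel (t - t) (Tzero a b)
| smc_scaleA y z t : smc_rel (y *: (z *: t)) ((y * z)%R *: t)
| smc_scale1 t : smc_rel (1%R *: t) t
| smc_scaleDr z t u : smc_rel (z *: (t + u)) (z *: t + z *: u)
| smc_scaleDl y z t : smc_rel ((y + z)%R *: t) (y *: t + z *: t)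
| smc_compDl t u v : smc_rel ((t + u) \oc v) ((t \oc v) + (u \oc v))
| smc_compDr t u v : smc_rel (t \oc (u + v)) ((t \oc u) + (t \oc v))
| smc_compZl z t u : smc_rel ((z *: t) \oc u) (z *: (t \oc u))
| smc_compZr z t u : smc_rel (t \oc (z *: u)) (z *: (t \oc u))
| smc_tensDl t u v : smc_rel ((t + u) \ox v) (t \ox v + u \ox v)
| smc_tensDr t u v : smc_rel (t \ox (u + v)) (t \ox u + t \ox v)
| smc_tensZl z t u : smc_rel ((z *: t) \ox u) (z *: (t \ox u))
| smc_tensZr z t u : smc_rel (t \ox (z *: u)) (z *: (t \ox u))
| smc_compA t u v : smc_rel (t \oc (u \oc v)) ((t \oc u) \oc v)
| smc_compid a t : smc_rel (t \oc Tid a) t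
| smc_idcomp b t : smc_rel (Tid b \oc t) t
| smc_tensA t u v : smc_rel (t \ox (u \ox v)) ((t \ox u) \ox v)
| smc_tensid0 t : smc_rel (t \ox Tid [::]) t
| smc_id0tens t : smc_rel (Tid [::] \ox t) t
| smc_tensid a b : smc_rel (Tid a \ox Tid b) (Tid (a ++ b))
| smc_interchange e e' t u v w : tpar e u -> tpar e' v ->
    smc_rel ((t \ox u) \oc (v \ox w))
            ((-1)%R ^+ (e && e') *: ((t \oc v) \ox (u \oc w))).

Inductive weq : seq nat -> seq nat -> term -> term -> Prop :=
| weq_smc a b t u :
    smc_rel t u -> typed a b t -> typed a b u -> weq a b t u
| weq_web a b t u :
    web_rel t u -> typed a b t -> typed a b u -> weq a b t u
| weq_refl a b t : typed a b t -> weq a b t t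
| weq_sym a b t u : weq a b t u -> weq a b u t
| weq_trans a b t u v : weq a b t u -> weq a b u v -> weq a b t v
| weq_comp a b c t t' u u' :
    weq b c t t' -> weq a b u u' -> weq a c (t \oc u) (t' \oc u')
| weq_tens a b c d t t' u u' :
    weq a b t t' -> weq c d u u' ->
    weq (a ++ c) (b ++ d) (t \ox u) (t' \ox u')
| weq_add a b t t' u u' :
    weq a b t t' -> weq a b u u' -> weq a b (t + u) (t' + u')
| weq_scale a b z t t' : weq a b t t' -> weq a b (z *: t) (z *: t').

End Web.

(** * The functor Psi_n *)

(* The (strict) monoidal superfunctors q-Web_up -> q(n)-Mod_S given by
   a |-> S^(a_1)(V_n) \otimes ... \otimes S^(a_r)(V_n) on objects. *)
Record superfunctor (C : numClosedFieldType) (n : nat) := Superfunctor {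
  fmap :> forall a b : seq nat, term C -> shom C (Sob n a) (Sob n b);
  fmap_weq : forall a b t u, weq a b t u -> fmap a b t = fmap a b u;
  fmap_qhom : forall a b t, typed a b t -> qhom (fmap a b t);
  fmap_par : forall a b e t, typed a b t -> tpar e t -> homog e (fmap a b t);
  fmap_add : forall a b t u, typed a b t -> typed a b u ->
    fmap a b (Tadd t u) = fmap a b t + fmap a b u;
  fmap_scale : forall a b z t, typed a b t ->
    fmap a b (Tscale z t) = z *: fmap a b t;
  fmap_id : forall a, wobj a -> fmap a a (Tid a) = sid C (Sob n a);
  fmap_comp : forall a b c t u, typed b c t -> typed a b u ->
    fmap a c (Tcomp t u) = scomp (fmap b c t) (fmap a b u);
  fmap_tens : forall a b c d t u, typed a b t -> typed c d u ->
    fmap (a ++ c) (b ++ d) (Ttens t u) = stenso (fmap a b t) (fmap c d u) }.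

(* The exponent of the sign of reordering w into (w restricted to the mask I)
   followed by (w restricted to its complement): the number of pairs s < t of
   positions of odd letters with s outside I and t in I. *)
Definition shuffle_inv n k (I : k.-tuple bool) (w : k.-tuple (letter n)) : nat :=
  (\sum_(s < k) \sum_(t < k)
     [&& (s < t)%N, ~~ tnth I s, tnth I t, (tnth w s).2 & (tnth w t).2])%N.

Record is_Psi (C : numClosedFieldType) (n : nat) (Psi : superfunctor C n) :
    Prop := IsPsi {
  Psi_dot : forall k (w : k.-tuple (letter n)), (0 < k)%N ->
    sapp (Psi [:: k] [:: k] (Tdot k)) (pure C [:: k] [:: val w])
    = \sum_(t < k)
        ((-1) ^+ wpar (take t w) * ((-1) ^+ (tnth w t).2 * 'i))
          *: pure C [:: k] [:: set_nth (tnth w t) w t (bar (tnth w t))];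
  Psi_merge : forall k l (u : k.-tuple (letter n)) (w : l.-tuple (letter n)),
    (0 < k)%N -> (0 < l)%N ->
    sapp (Psi [:: k; l] [:: (k + l)%N] (Tmerge k l))
         (pure C [:: k; l] [:: val u; val w])
    = pure C [:: (k + l)%N] [:: u ++ w];
  Psi_split : forall k l (w : (k + l).-tuple (letter n)),
    (0 < k)%N -> (0 < l)%N ->
    sapp (Psi [:: (k + l)%N] [:: k; l] (Tsplit k l))
         (pure C [:: (k + l)%N] [:: val w])
    = \sum_(I : (k + l).-tuple bool | count id I == k)
        (-1) ^+ shuffle_inv I w
          *: pure C [:: k; l] [:: mask I w; mask (map negb I) w] }.

Definition full_functor (C : numClosedFieldType) (n : nat)
    (Psi : superfunctor C n) : Prop :=
  forall a b : seq nat, wobj a -> wobj b ->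
  forall f : shom C (Sob n a) (Sob n b), qhom f ->
  exists2 t : term C, typed a b t & Psi a b t = f.

(* Main.v *)
Require Import Defs.
From HB Require Import structures.
From mathcomp Require Import all_boot all_fingroup all_order all_algebra.
From mathcomp Require Import reals.

(* The thickness-k strand is a direct summand, through merges and splits, of k
   thin strands, so it suffices to show that the endomorphisms of V^{(x) k} over
   q(n) are spanned by the Sergeev algebra, which is generated by the images of
   dots and crossings on thin strands.  This is a double commutant argument.
   Averaging an operator over the Clifford generators and over the symmetric
   group gives a sum of operators that place elements x_1, ..., x_k of q(n) at
   the k sites in all possible orders; multiplying such sums by
   Delta(x) = \sum_i x^{(i)} shows, by induction on the number of sites used,
   that they lie in the algebra generated by q(n).  An endomorphism commuting
   with q(n) thus commutes with all averages, hence lies in the Sergeev algebra.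
   Odd endomorphisms are reduced to even ones by composing with a dot. *)

Set Implicit Arguments.
Unset Strict Implicit.
Unset Printing Implicit Defensive.
Import GRing.Theory Num.Theory.
Local Open Scope ring_scope.

(** * Linear maps of superspaces *)

(** The statement is graded, while the double commutant argument is run without grading. Odd maps
    obey signed commutation relations, so the odd Sergeev generators are first multiplied by the
    parity involution [G], which makes them commute with everything at the other sites; the part
    with [G] is removed at the end by comparing parities. No semisimplicity theorem is invoked: the
    argument rests on an explicit average X |-> sum a X b whose coefficients satisfy sum a b = N
    with N a nonzero scalar, and on [f] commuting with the averages. The averages can be computed
    because x + (-1)^e c x c supercommutes with [c] as soon as c^2 = 1: Clifford averaging moves
    each tensor factor into q(n). The condition defining q(n) is also stable under associative
    products, so when two factors meet at one site their product is again admissible; this is why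
    the induction on the number of sites closes. *)

Section SuperMaps.
Variable C : numClosedFieldType.
Implicit Types M N P Q : superspace.

Lemma scompE M N P (g : shom C N P) (f : shom C M N) p q :
  scomp g f (p, q) = \sum_y g (p, y) * f (y, q).
Proof. by rewrite ffunE. Qed.

Lemma sidE M p q : sid C M (p, q) = (p == q)%:R.
Proof. by rewrite ffunE. Qed.

Lemma hpartE e M N (f : shom C M N) p q :
  hpart e f (p, q) = if spar p (+) spar q == e then f (p, q) else 0.
Proof. by rewrite ffunE. Qed.

Lemma stensmE M N M' N' (f : shom C M N) (g : shom C M' N') p p' q q' :
  stensm f g ((p, p'), (q, q'))
  = (-1) ^+ ((spar p' (+) spar q') && spar q) * (f (p, q) * g (p', q')).
Proof. by rewrite ffunE. Qed.

Lemma shomP M N (f g : shom C M N) :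
  (forall p q, f (p, q) = g (p, q)) -> f = g.
Proof. by move=> fg; apply/ffunP => -[p q]. Qed.

Lemma addsE M N (f g : shom C M N) p : (f + g) p = f p + g p.
Proof. by rewrite ffunE. Qed.

Lemma scalesE M N a (f : shom C M N) p : (a *: f) p = a * f p.
Proof. by rewrite ffunE. Qed.

Lemma scompA M N P Q (h : shom C P Q) (g : shom C N P) (f : shom C M N) :
  scomp h (scomp g f) = scomp (scomp h g) f.
Proof.
apply: shomP => p q; rewrite !scompE.
under eq_bigr do rewrite scompE big_distrr /=.
rewrite exchange_big; apply: eq_bigr => y _.
by rewrite scompE big_distrl; apply: eq_bigr => z _; rewrite /= mulrA.
Qed.

Lemma scomp1l M N (f : shom C M N) : scomp (sid C N) f = f.
Proof.
apply: shomP => p q; rewrite scompE (bigD1 p) //= sidE eqxx mul1r.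
by rewrite big1 ?addr0 // => y /negPf; rewrite sidE eq_sym => ->; rewrite mul0r.
Qed.

Lemma scomp1r M N (f : shom C M N) : scomp f (sid C M) = f.
Proof.
apply: shomP => p q; rewrite scompE (bigD1 q) //= sidE eqxx mulr1.
by rewrite big1 ?addr0 // => y /negPf; rewrite sidE => ->; rewrite mulr0.
Qed.

Lemma scompDl M N P (g g' : shom C N P) (f : shom C M N) :
  scomp (g + g') f = scomp g f + scomp g' f.
Proof.
apply: shomP => p q; rewrite addsE !scompE -big_split; apply: eq_bigr => y _.
by rewrite addsE mulrDl.
Qed.

Lemma scompDr M N P (g : shom C N P) (f f' : shom C M N) :
  scomp g (f + f') = scomp g f + scomp g f'.
Proof.
apply: shomP => p q; rewrite addsE !scompE -big_split; apply: eq_bigr => y _.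
by rewrite addsE mulrDr.
Qed.

Lemma scompZl M N P a (g : shom C N P) (f : shom C M N) :
  scomp (a *: g) f = a *: scomp g f.
Proof.
apply: shomP => p q; rewrite scalesE !scompE mulr_sumr; apply: eq_bigr => y _.
by rewrite scalesE mulrA.
Qed.

Lemma scompZr M N P a (g : shom C N P) (f : shom C M N) :
  scomp g (a *: f) = a *: scomp g f.
Proof.
apply: shomP => p q; rewrite scalesE !scompE mulr_sumr; apply: eq_bigr => y _.
by rewrite scalesE mulrCA.
Qed.

Lemma scomp0l M N P (f : shom C M N) : scomp (0 : shom C N P) f = 0.
Proof. by rewrite -(scale0r 0) scompZl scale0r. Qed.

Lemma scomp0r M N P (g : shom C N P) : scomp g (0 : shom C M N) = 0.
Proof. by rewrite -(scale0r 0) scompZr scale0r. Qed.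

Lemma hpartD M N (f : shom C M N) : f = hpart false f + hpart true f.
Proof.
apply: shomP => p q; rewrite addsE !hpartE.
by case: (spar p (+) spar q); rewrite ?addr0 ?add0r.
Qed.

Lemma homogP e M N (f : shom C M N) :
  homog e f <-> forall p q, spar p (+) spar q != e -> f (p, q) = 0.
Proof.
split=> [<- p q /negPf | f0]; first by rewrite hpartE => ->.
by apply: shomP => p q; rewrite hpartE; case: ifPn => // /f0.
Qed.

Lemma homog_hpart e M N (f : shom C M N) : homog e (hpart e f).
Proof. by apply/homogP => p q /negPf; rewrite hpartE => ->. Qed.

Lemma hpart_homog e e' M N (f : shom C M N) :
  homog e f -> hpart e' f = if e == e' then f else 0.
Proof.
move=> hf; case: (e =P e') => [<- //|ee']; apply: shomP => p q; rewrite hpartE.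
case: eqP => pq; last by rewrite ffunE.
by rewrite ((homogP _ _).1 hf) ?ffunE // pq; apply/eqP => /esym.
Qed.

Lemma homogD e M N (f g : shom C M N) :
  homog e f -> homog e g -> homog e (f + g).
Proof.
move=> /homogP hf /homogP hg; apply/homogP => p q pq.
by rewrite addsE hf // hg // addr0.
Qed.

Lemma homogZ e M N a (f : shom C M N) : homog e f -> homog e (a *: f).
Proof.
by move=> /homogP hf; apply/homogP => p q pq; rewrite scalesE hf // mulr0.
Qed.

Lemma homog_id M : homog false (sid C M).
Proof. by apply/homogP => p q; rewrite sidE; case: (p =P q) => // ->; rewrite addbb. Qed.

Lemma homog_comp e e' M N P (g : shom C N P) (f : shom C M N) :
  homog e g -> homog e' f -> homog (e (+) e') (scomp g f).
Proof.
move=> /homogP hg /homogP hf; apply/homogP => p q pq; rewrite scompE big1 // => y _.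
case: (boolP (spar p (+) spar y == e)) => [/eqP ey | /hg ->]; last by rewrite mul0r.
rewrite hf ?mulr0 //; apply: contraNneq pq => <-; rewrite -ey.
by rewrite -addbA (addbA (spar y)) addbb.
Qed.

Lemma homog_tens e e' M N M' N' (f : shom C M N) (g : shom C M' N') :
  homog e f -> homog e' g -> homog (e (+) e') (stensm f g).
Proof.
move=> /homogP hf /homogP hg; apply/homogP => -[p p'] [q q'] /= pq.
rewrite stensmE.
case: (boolP (spar p (+) spar q == e)) => [/eqP ey | /hf ->]; last by rewrite mul0r mulr0.
rewrite hg ?mulr0 //; apply: contraNneq pq => <-; rewrite -ey.
by rewrite addbACA.
Qed.

Lemma homog_inter M N (f : shom C M N) : homog false f -> homog true f -> f = 0.
Proof. by move=> h0 h1; rewrite -h0 (hpart_homog _ h1). Qed.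

Lemma hpart_sandwich e M N P Q (h : shom C P Q) (f : shom C N P) (g : shom C M N) :
  homog false h -> homog false g ->
  hpart e (scomp h (scomp f g)) = scomp h (scomp (hpart e f) g).
Proof.
move=> hh hg.
have hE e' : homog e' (scomp h (scomp (hpart e' f) g)).
  have := homog_comp hh (homog_comp (homog_hpart e' f) hg).
  by rewrite addbF.
rewrite {1}(hpartD f) scompDl scompDr.
have hD (u v : shom C M Q) : hpart e (u + v) = hpart e u + hpart e v.
  by apply: shomP => p q; rewrite addsE !hpartE addsE; case: ifP; rewrite ?addr0.
by rewrite hD !(hpart_homog _ (hE _)); case: (e); rewrite ?addr0 ?add0r.
Qed.

Lemma sbracket_homog e e' M (x y : shom C M M) : homog e x -> homog e' y ->
  sbracket x y = scomp x y - (-1) ^+ (e && e') *: scomp y x.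
Proof.
move=> hx hy; rewrite /sbracket !big_bool /= !(hpart_homog _ hx) !(hpart_homog _ hy).
by case: e {hx}; case: e' {hy};
  rewrite /= !(scomp0l, scomp0r, scaler0, oppr0, addr0, add0r).
Qed.

(** Only [g] and [h] change places, so only they need a parity. In the nonzero terms of the matrix
    product the parities of the intermediate indices are tied to [e] and [e'], and the signs are
    compared case by case. *)
Lemma stensm_comp e e' M N P M' N' P' (f : shom C N P) (g : shom C N' P')
    (h : shom C M N) (k : shom C M' N') :
  homog e g -> homog e' h ->
  scomp (stensm f g) (stensm h k)
  = (-1) ^+ (e && e') *: stensm (scomp f h) (scomp g k).
Proof.
move=> /homogP hg /homogP hh; apply: shomP => -[p p'] [q q'].
rewrite scalesE stensmE !scompE big_distrlr /= pair_big /= !big_distrr /=.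
apply: eq_bigr => -[y y'] _; rewrite !stensmE /=.
case: (boolP (spar p' (+) spar y' == e)) => [/eqP ee | /hg ->]; last first.
  by rewrite !(mulr0, mul0r).
case: (boolP (spar y (+) spar q == e')) => [/eqP ee' | /hh ->]; last first.
  by rewrite !(mulr0, mul0r).
have -> : spar p' (+) spar q' = e (+) (spar y' (+) spar q').
  by rewrite -ee -addbA (addbA (spar y')) addbb.
have -> : spar q = e' (+) spar y by rewrite -ee' addbAC addbb.
rewrite ee; case: (e); case: (e'); case: (spar y); case: (spar y' (+) spar q') => /=;
  rewrite ?(expr0, expr1, mul1r, mulN1r, mulrNN, mulrN, mulNr, opprK);
  by rewrite ?mulrA -?(mulrA (f _)) ?(mulrC (g _)) ?mulrA.
Qed.

Lemma stensm_id M M' : stensm (sid C M) (sid C M') = sid C (stens M M').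
Proof.
apply: shomP => -[p p'] [q q']; rewrite stensmE !sidE.
have -> : ((p, p') == (q, q') :> stens M M') = (p == q) && (p' == q') by [].
case: (p == q); have [->|_] := p' =P q';
  by rewrite ?addbb ?mulr0 ?mul0r ?mulr0 ?mul1r.
Qed.

Lemma stensmDl M N M' N' (f f' : shom C M N) (g : shom C M' N') :
  stensm (f + f') g = stensm f g + stensm f' g.
Proof.
by apply: shomP => -[p p'] [q q']; rewrite addsE !stensmE addsE mulrDl mulrDr.
Qed.

Lemma stensmDr M N M' N' (f : shom C M N) (g g' : shom C M' N') :
  stensm f (g + g') = stensm f g + stensm f g'.
Proof.
by apply: shomP => -[p p'] [q q']; rewrite addsE !stensmE addsE mulrDr mulrDr.
Qed.

Lemma stensmZl M N M' N' a (f : shom C M N) (g : shom C M' N') :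
  stensm (a *: f) g = a *: stensm f g.
Proof.
apply: shomP => -[p p'] [q q']; rewrite scalesE !stensmE scalesE.
by rewrite -mulrA mulrCA.
Qed.

Lemma stensmZr M N M' N' a (f : shom C M N) (g : shom C M' N') :
  stensm f (a *: g) = a *: stensm f g.
Proof.
apply: shomP => -[p p'] [q q']; rewrite scalesE !stensmE scalesE.
by rewrite (mulrCA (f _) a) (mulrCA _ a).
Qed.

End SuperMaps.

(* A separate name keeps the composition ring apart from the pointwise ring
   structure of {ffun _ -> _}. *)
Definition op (C : numClosedFieldType) (M : superspace) : Type := shom C M M.

Section OpRing.
Variables (C : numClosedFieldType) (M : superspace).

Implicit Types x y : op C M.

HB.instance Definition _ := Vector.copy (op C M) {ffun M * M -> C^o}.
(* Sealed, so that unification never evaluates a product of maps. *)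
Fact opmul_key : unit. Proof. by []. Qed.
Definition opmul : op C M -> op C M -> op C M :=
  locked_with opmul_key (@scomp C M M M).

Lemma opmulE x y : opmul x y = scomp x y.
Proof. by rewrite /opmul unlock. Qed.

Fact opmulA : associative opmul.
Proof. by move=> x y z; rewrite !opmulE scompA. Qed.
Fact opmul1l : left_id (sid C M : op C M) opmul.
Proof. by move=> x; rewrite opmulE scomp1l. Qed.
Fact opmul1r : right_id (sid C M : op C M) opmul.
Proof. by move=> x; rewrite opmulE scomp1r. Qed.
Fact opmulDl : left_distributive opmul +%R.
Proof. by move=> x y z; rewrite !opmulE scompDl. Qed.
Fact opmulDr : right_distributive opmul +%R.
Proof. by move=> x y z; rewrite !opmulE scompDr. Qed.

HB.instance Definition _ := GRing.Zmodule_isPzRing.Build (op C M)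
  opmulA opmul1l opmul1r opmulDl opmulDr.

Lemma opM x y : x * y = scomp x y. Proof. exact: opmulE. Qed.
Lemma opME x y p q : (x * y : shom C M M) (p, q)
  = \sum_z (x : shom C M M) (p, z) * (y : shom C M M) (z, q).
Proof. by rewrite opM scompE. Qed.
Lemma opZl a x y : (a *: x) * y = a *: (x * y).
Proof. by rewrite !opM; apply: scompZl. Qed.
Lemma opZr a x y : x * (a *: y) = a *: (x * y).
Proof. by rewrite !opM; apply: scompZr. Qed.

Lemma op_sumE I (r : seq I) (P : pred I) (F : I -> op C M) (p : M * M) :
  (\sum_(i <- r | P i) F i : op C M) p = \sum_(i <- r | P i) (F i : shom C M M) p.
Proof.
elim/big_rec2: _ => [|i y x _ <-]; first by rewrite ffunE.
exact: (addsE (F i : shom C M M) x p).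
Qed.

End OpRing.

(** * The double commutant argument *)

Section DoubleCommutant.
Variables (C : numClosedFieldType) (M : superspace).
Local Notation op := (op C M).
Variable A : op -> Prop.
Hypotheses (A1 : A 1) (AD : forall x y, A x -> A y -> A (x + y))
  (AZ : forall a x, A x -> A (a *: x)) (AM : forall x y, A x -> A y -> A (x * y)).

(** The pairs in [s] play the role of a separability idempotent of [A], kept unnormalised:
    [F 1 = N]. The two-sided form with coefficients in [A] is stable under composition. *)
Definition averaging (F : op -> op) : Prop :=
  exists s : seq (op * op), exists2 N : C, N != 0 &
  [/\ forall p, p \in s -> A p.1 /\ A p.2,
      \sum_(p <- s) p.1 * p.2 = N *: (1 : op)
    & forall X, F X = \sum_(p <- s) p.1 * X * p.2].

Lemma averaging_comp F G : averaging F -> averaging G -> averaging (F \o G).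
Proof.
move=> [s [N N0 [sA sN sF]]] [s' [N' N'0 [sA' sN' sF']]].
exists [seq (p.1 * q.1, q.2 * p.2) | p <- s, q <- s'], (N' * N).
  by rewrite mulf_neq0.
split=> [p | |X].
- case/allpairsP => -[u v] [/= /sA [? ?] /sA' [? ?] ->]; split; exact: AM.
- rewrite big_allpairs_dep /= -scalerA -sN scaler_sumr.
  apply: eq_bigr => p _.
  under eq_bigr => q _ do rewrite mulrA -(mulrA p.1).
  by rewrite -mulr_suml -mulr_sumr sN' opZr mulr1 opZl.
- rewrite /= sF big_allpairs_dep; apply: eq_bigr => p _ /=.
  rewrite sF' mulr_sumr mulr_suml; apply: eq_bigr => q _.
  by rewrite !mulrA.
Qed.

Lemma span_closed (s : seq op) x :
  (forall y, y \in s -> A y) -> x \in <<s>>%VS -> A x.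
Proof.
move=> sA xs; rewrite (@coord_span _ _ _ (in_tuple s) x xs).
elim/big_rec: _ => [|i y _ Ay]; first by rewrite -(scale0r (1 : op)); apply: AZ.
by apply: AD => //; apply: AZ; apply: sA; rewrite mem_nth.
Qed.

Definition unit_op (p q : M) : op := [ffun r => (r == (p, q))%:R].

Lemma op_unitE (x : op) : x = \sum_(r : M * M) (x : shom C M M) r *: unit_op r.1 r.2.
Proof.
apply/ffunP => r; rewrite op_sumE (bigD1 r) //= ffunE ffunE -surjective_pairing eqxx.
rewrite [_ *: _]mulr1 big1 ?addr0 // => t tr.
by rewrite ffunE ffunE -surjective_pairing eq_sym (negPf tr) scaler0.
Qed.

(* With p0 a projection onto the span of the b_j, the map
   p(X) = \sum_j a_j p0(b_j X) takes values in A and satisfies p(1) = N; its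
   matrix is built from left multiplications by operators in the range of F,
   hence p(f) = f p(1). *)
Lemma double_commutant F f :
  averaging F -> (forall X, f * F X = F X * f) -> A f.
Proof.
move=> [s [N N0 [sA sN sF]]] fF.
pose p0 := projv <<[seq p.2 | p <- s]>>%VS.
pose P (X : op) := \sum_(p <- s) p.1 * p0 (p.2 * X).
have AP X : A (P X).
  rewrite /P big_seq; elim/big_rec: _ => [|p y ps Ay].
    by rewrite -(scale0r (1 : op)); apply: AZ.
  apply: AD => //; apply: AM; first by case: (sA p ps).
  apply: span_closed (memv_proj _ _) => y' /mapP[q qs ->].
  by case: (sA q qs).
have P1 : P 1 = N *: (1 : op).
  rewrite -sN /P big_seq [RHS]big_seq; apply: eq_bigr => p ps.
  by rewrite mulr1 /p0 projv_id // memv_span // map_f.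
(* [p0] is merely linear on operators. [S r v] collects the entries in column [v] of its values on
   the matrix units with column [r], so that [p0 Y] becomes a sum of entries of the products
   [S r v * Y]. *)
pose S (r v : M) : op := [ffun t => (p0 (unit_op t.2 r) : shom C M M) (t.1, v)].
have p0E Y w v : (p0 Y : shom C M M) (w, v) = \sum_r (S r v * Y : shom C M M) (w, r).
  rewrite {1}[Y]op_unitE linear_sum op_sumE /=.
  under [RHS]eq_bigr do rewrite opME.
  rewrite exchange_big /= pair_big; apply: eq_bigr => -[q r] _.
  by rewrite linearZ ffunE /= mulrC ffunE.
have PE X u v : (P X : shom C M M) (u, v) = \sum_r (F (S r v) * X : shom C M M) (u, r).
  rewrite /P op_sumE.
  under eq_bigr => p _ do
    (rewrite opME; under eq_bigr => w _ do rewrite p0E mulr_sumr).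
  under eq_bigr => p _ do rewrite exchange_big /=.
  rewrite exchange_big; apply: eq_bigr => r _ /=.
  rewrite sF mulr_suml op_sumE; apply: eq_bigr => p _.
  by rewrite -!mulrA opME.
have Pf : P f = f * P 1.
  apply: shomP => u v; rewrite PE opME.
  under [RHS]eq_bigr => z _ do rewrite PE mulr_sumr.
  rewrite exchange_big; apply: eq_bigr => r _ /=.
  by rewrite -fF opME; apply: eq_bigr => z _; rewrite mulr1.
have -> : f = N^-1 *: P f.
  by rewrite Pf P1 opZr mulr1 scalerA mulVf // scale1r.
exact: AZ.
Qed.

End DoubleCommutant.

#[local] Opaque stensm sid scomp.

(** * Operators on tensor powers *)

Section Sites.
Variables (C : numClosedFieldType) (n : nat).
Local Notation V := (Defs.Sym n 1).
Implicit Types M : superspace.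
Local Notation W k := (Sob n (nseq k 1%N)).
Local Notation opV := (op C V).
Local Notation opW k := (op C (W k)).

Fact site_key : unit. Proof. by []. Qed.

Definition headop k : opV -> opW k.+1 :=
  locked_with site_key (fun x => stensm x (sid C (W k))).
Definition shiftop k : opW k -> opW k.+1 :=
  locked_with site_key (fun g => stensm (sid C V) g).

Lemma headop_def k x : headop k x = stensm x (sid C (W k)).
Proof. by rewrite /headop unlock. Qed.

Lemma shiftop_def k (g : opW k) : shiftop g = stensm (sid C V) g.
Proof. by rewrite /shiftop unlock. Qed.

Lemma headopD k (x y : opV) : headop k (x + y) = headop k x + headop k y.
Proof. by rewrite !headop_def; apply: stensmDl. Qed.

Lemma shiftopD k (g h : opW k) : shiftop (g + h) = shiftop g + shiftop h.
Proof. by rewrite !shiftop_def; apply: stensmDr. Qed.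

Lemma headopZ k a (x : opV) : headop k (a *: x) = a *: headop k x.
Proof. by rewrite !headop_def; apply: stensmZl. Qed.

Lemma shiftopZ k a (g : opW k) : shiftop (a *: g) = a *: shiftop g.
Proof. by rewrite !shiftop_def; apply: stensmZr. Qed.

Lemma headopM k (x y : opV) : headop k (x * y) = headop k x * headop k y.
Proof.
(* [stensm_comp] wants homogeneous inner factors; each part of [y] then passes an identity, which is
   even, so no sign appears. *)
have [y0 y1] : exists y0 : opV, exists2 y1 : opV,
    homog false (y0 : shom C V V) /\ homog true (y1 : shom C V V) & y = y0 + y1.
  exists (hpart false (y : shom C V V)), (hpart true (y : shom C V V)).
    by split; apply: homog_hpart.
  exact: hpartD.
case: y1 => y1 [h0 h1] ->; rewrite mulrDr !headopD mulrDr.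
by congr (_ + _); rewrite !opM !headop_def;
  [rewrite (stensm_comp _ _ (@homog_id C (W k)) h0)
  |rewrite (stensm_comp _ _ (@homog_id C (W k)) h1)]; rewrite scale1r scomp1l.
Qed.

Lemma shiftopM k (g h : opW k) : shiftop (g * h) = shiftop g * shiftop h.
Proof.
have [g0 g1] : exists g0 : opW k, exists2 g1 : opW k,
    homog false (g0 : shom C _ _) /\ homog true (g1 : shom C _ _) & g = g0 + g1.
  exists (hpart false (g : shom C _ _)), (hpart true (g : shom C _ _)).
    by split; apply: homog_hpart.
  exact: hpartD.
case: g1 => g1 [h0 h1] ->; rewrite mulrDl !shiftopD mulrDl.
by congr (_ + _); rewrite !opM !shiftop_def;
  [rewrite (stensm_comp _ _ h0 (@homog_id C V))
  |rewrite (stensm_comp _ _ h1 (@homog_id C V))]; rewrite andbF scale1r scomp1l.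
Qed.

Lemma shiftop1 k : shiftop (1 : opW k) = 1.
Proof. by rewrite shiftop_def; apply: stensm_id. Qed.

Lemma headop1 k : headop k 1 = 1.
Proof. by rewrite headop_def; apply: stensm_id. Qed.

Lemma head_shift k (x : opV) (g : opW k) : headop k x * shiftop g = stensm x g.
Proof.
rewrite opM headop_def shiftop_def.
rewrite (stensm_comp _ _ (@homog_id C (W k)) (@homog_id C V)).
by rewrite scale1r scomp1l scomp1r.
Qed.

Lemma shift_head e e' k (x : opV) (g : opW k) :
  homog e (x : shom C _ _) -> homog e' (g : shom C _ _) ->
  shiftop g * headop k x = (-1) ^+ (e && e') *: (headop k x * shiftop g).
Proof.
move=> hx hg; rewrite head_shift opM shiftop_def headop_def.
by rewrite (stensm_comp _ _ hg hx) scomp1l scomp1r andbC.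
Qed.

(** Beyond the last strand the value is 0, so multiplicativity and supercommutation hold without a
    bound on [i]. The Koszul signs are produced by [shiftop]. *)
Fixpoint site k (i : nat) (x : opV) : opW k :=
  match k return opW k with
  | 0 => 0
  | k'.+1 => if i is i'.+1 then shiftop (site k' i' x) else headop k' x
  end.

Lemma site_homog e k i (x : opV) :
  homog e (x : shom C _ _) -> homog e (site k i x : shom C _ _).
Proof.
move=> hx; elim: k i => [|k IH] [|i] /=.
- by apply/homogP => p q _; rewrite ffunE.
- by apply/homogP => p q _; rewrite ffunE.
- by rewrite headop_def -(addbF e); apply: homog_tens => //; apply: homog_id.
- by rewrite shiftop_def -(addFb e); apply: homog_tens => //; apply: homog_id.
Qed.

Lemma siteM k i (x y : opV) : site k i (x * y) = site k i x * site k i y.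
Proof.
elim: k i => [|k IH] [|i] /=; rewrite ?mul0r //; first exact: headopM.
by rewrite IH shiftopM.
Qed.

Lemma siteD k i (x y : opV) : site k i (x + y) = site k i x + site k i y.
Proof.
elim: k i => [|k IH] [|i] /=; rewrite ?addr0 //; first exact: headopD.
by rewrite IH shiftopD.
Qed.

Lemma siteZ k i a (x : opV) : site k i (a *: x) = a *: site k i x.
Proof.
elim: k i => [|k IH] [|i] /=; rewrite ?scaler0 //; first exact: headopZ.
by rewrite IH shiftopZ.
Qed.

Lemma site1 k i : (i < k)%N -> site k i 1 = 1.
Proof.
elim: k i => [|k IH] [|i] //= ik; first exact: headop1.
by rewrite IH // shiftop1.
Qed.

Lemma site_comm e e' k i j (x y : opV) :
  homog e (x : shom C _ _) -> homog e' (y : shom C _ _) -> i != j ->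
  site k i x * site k j y = (-1) ^+ (e && e') *: (site k j y * site k i x).
Proof.
move=> hx hy; elim: k i j => [|k IH] [|i] [|j] //= ij; rewrite ?mul0r ?scaler0 //.
- rewrite (shift_head hx (site_homog k j hy)) scalerA -exprD.
  by rewrite addnn -mul2n exprM sqrrN expr1n expr1n scale1r.
- by rewrite (shift_head hy (site_homog k i hx)) andbC.
- by rewrite -!shiftopM (IH i j) // shiftopZ.
Qed.

(** The grading involution. Moving it past an odd operator costs exactly the sign by which
    anticommuting differs from commuting. *)
Definition parity_op M : op C M := [ffun r => (r.1 == r.2)%:R * (-1) ^+ spar r.1].

Lemma parity_opl M (x : op C M) p q :
  (parity_op M * x : shom C M M) (p, q) = (-1) ^+ spar p * (x : shom C M M) (p, q).
Proof.
rewrite opME (bigD1 p) //= ffunE eqxx mul1r big1 ?addr0 // => y /negPf.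
by rewrite ffunE eq_sym => ->; rewrite !mul0r.
Qed.

Lemma parity_opr M (x : op C M) p q :
  (x * parity_op M : shom C M M) (p, q) = (-1) ^+ spar q * (x : shom C M M) (p, q).
Proof.
rewrite opME (bigD1 q) //= ffunE eqxx mul1r big1 ?addr0 1?mulrC // => y /negPf.
by rewrite ffunE => ->; rewrite mul0r mulr0.
Qed.

Lemma parity_op_comm e M (x : op C M) : homog e (x : shom C _ _) ->
  parity_op M * x = (-1) ^+ e *: (x * parity_op M).
Proof.
move=> /homogP hx; apply: shomP => p q; rewrite parity_opl scalesE parity_opr.
case: (boolP (spar p (+) spar q == e)) => [/eqP <- | /hx ->]; last by rewrite !mulr0.
by rewrite mulrA signr_addb -(mulrA (_ ^+ spar p)) -expr2 sqrr_sign mulr1.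
Qed.

Lemma parity_op2 M : parity_op M * parity_op M = 1.
Proof.
apply: shomP => p q; rewrite parity_opl ffunE [RHS]sidE /=.
by case: eqP => _; case: (spar p); rewrite /= ?mul0r ?mulr0 // ?mul1r ?mulrNN ?mulr1.
Qed.

Lemma homog_parity_op M : homog false (parity_op M : shom C _ _).
Proof.
by apply/homogP => p q; rewrite ffunE /=; case: (p =P q) => [-> | _];
  rewrite ?addbb // mul0r.
Qed.

Lemma unit_op_homog M (p q : M) :
  homog (spar p (+) spar q) (unit_op C p q : shom C _ _).
Proof.
apply/homogP => p' q'; rewrite ffunE; case: ((p', q') =P _) => // -[-> ->].
by rewrite eqxx.
Qed.

Lemma unit_op_sites k (p q : W k) :
  exists x : nat -> opV, exists e : nat -> bool, exists2 a : C,
    forall i, homog (e i) (x i : shom C _ _) &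
    unit_op C p q = a *: \prod_(i < k) site k i (x i).
Proof.
elim: k p q => [|k IH] p q.
  exists (fun=> 0), (fun=> false), 1.
    by move=> i; apply/homogP => p' q' _; rewrite ffunE.
  rewrite big_ord0 scale1r; apply/shomP => -[] []; case: p; case: q.
  by rewrite [RHS]sidE ffunE !eqxx.
case: p q => [p p'] [q q'].
have [x [e [a hx Ea]]] := IH p' q'.
pose s : C := (-1) ^+ ((spar p' (+) spar q') && spar q).
exists (fun i => if i is i'.+1 then x i' else unit_op C p q : opV).
exists (fun i => if i is i'.+1 then e i' else spar p (+) spar q).
exists (s * a); first by case=> [|i] //; apply: unit_op_homog.
have shift_prod : \prod_(i < k) shiftop (site k i (x i))
    = shiftop (\prod_(i < k) site k i (x i)).
  by rewrite (big_morph (@shiftop k) (@shiftopM k) (shiftop1 k)).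
rewrite big_ord_recl /= shift_prod -scalerA.
have -> : a *: (headop k (unit_op C p q) * shiftop (\prod_(i < k) site k i (x i)))
    = stensm (unit_op C p q : shom C _ _) (unit_op C p' q').
  by rewrite head_shift Ea; apply/esym; apply: stensmZr.
apply: shomP => -[u u'] [v v']; rewrite scalesE stensmE !ffunE.
have -> : ((u, u', (v, v')) == (p, p', (q, q')) :> (W k.+1 * W k.+1)%type)
    = ((u, v) == (p, q)) && ((u', v') == (p', q')).
  by rewrite !xpair_eqE; rewrite andbACA.
case: eqP => [[_ ->] | _]; last by rewrite mul0r !mulr0.
case: eqP => [[-> ->] | _]; last by rewrite !mulr0.
by rewrite /s (mulr1 1) mulr1 -expr2 sqrr_sign.
Qed.

(** The superflip of the first two tensor factors. *)
Definition swap0 k : opW k.+2 :=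
  [ffun r : (V * (V * W k)) * (V * (V * W k)) =>
     [&& r.1.1 == r.2.2.1, r.1.2.1 == r.2.1 & r.1.2.2 == r.2.2.2]%:R
     * (-1) ^+ (spar r.2.1 && spar r.2.2.1)].

Lemma swap0l k (g : opW k.+2) p1 p2 p3 q :
  (swap0 k * g : shom C _ _) ((p1, (p2, p3)), q)
  = (-1) ^+ (spar p1 && spar p2) * (g : shom C _ _) ((p2, (p1, p3)), q).
Proof.
rewrite opME (bigD1 (p2, (p1, p3) : W k.+1)) //= ffunE !eqxx mul1r andbC.
rewrite big1 ?addr0 // => -[y1 [y2 y3]] yp; rewrite ffunE /=.
have -> : [&& p1 == y2, p2 == y1 & p3 == y3] = false.
  apply: contraNF yp => /and3P[/eqP-> /eqP-> /eqP->].
  by rewrite eqxx.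
by rewrite !mul0r.
Qed.

Lemma swap0r k (g : opW k.+2) p q1 q2 q3 :
  (g * swap0 k : shom C _ _) (p, (q1, (q2, q3)))
  = (-1) ^+ (spar q1 && spar q2) * (g : shom C _ _) (p, (q2, (q1, q3))).
Proof.
rewrite opME (bigD1 (q2, (q1, q3) : W k.+1)) //= ffunE !eqxx mul1r mulrC.
rewrite big1 ?addr0 // => -[y1 [y2 y3]] yp; rewrite ffunE /=.
have -> : [&& y1 == q2, y2 == q1 & y3 == q3] = false.
  apply: contraNF yp => /and3P[/eqP-> /eqP-> /eqP->].
  by rewrite eqxx.
by rewrite mul0r mulr0.
Qed.

Lemma swap0_homog k : homog false (swap0 k : shom C _ _).
Proof.
apply/homogP => -[p1 [p2 p3]] [q1 [q2 q3]] /=; rewrite ffunE.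
case: (p1 =P q2) => [-> | _]; last by rewrite mul0r.
case: (p2 =P q1) => [-> | _]; last by rewrite mul0r.
case: (p3 =P q3) => [-> | _]; last by rewrite mul0r.
by rewrite (addbCA (spar q2)) addbb.
Qed.

Lemma swap02 k : swap0 k * swap0 k = 1.
Proof.
apply: shomP => -[p1 [p2 p3]] q; rewrite swap0l ffunE [RHS]sidE; case: q => q1 [q2 q3].
have -> : ((p1, (p2, p3)) == (q1, (q2, q3)) :> W k.+2)
  = [&& p1 == q1, p2 == q2 & p3 == q3] by [].
rewrite andbCA; case: (p1 =P q1) => [-> | _] /=; last by rewrite mul0r mulr0.
case: (p2 =P q2) => [-> | _] /=; last by rewrite mul0r mulr0.
by rewrite mulrCA; case: (_ && _); rewrite /= ?mulrNN !mulr1.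
Qed.

Lemma headopE k x (p q : V) (p' q' : W k) :
  (headop k x : shom C (W k.+1) (W k.+1)) ((p, p'), (q, q'))
  = (-1) ^+ ((spar p' (+) spar q') && spar q)
    * ((x : shom C _ _) (p, q) * (p' == q')%:R).
Proof. by rewrite headop_def -(sidE C); apply: stensmE. Qed.

Lemma shiftopE k g (p q : V) (p' q' : W k) :
  (shiftop g : shom C (W k.+1) (W k.+1)) ((p, p'), (q, q'))
  = (-1) ^+ ((spar p' (+) spar q') && spar q)
    * ((p == q)%:R * (g : shom C _ _) (p', q')).
Proof. by rewrite shiftop_def -(sidE C); apply: stensmE. Qed.

Lemma swap0_head k (x : opV) :
  swap0 k * headop k.+1 x = shiftop (headop k x) * swap0 k.
Proof.
apply: shomP => -[p1 [p2 p3]] [q1 [q2 q3]]; rewrite [LHS]swap0l [RHS]swap0r.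
rewrite !shiftopE !headopE /=.
have -> : ((p1, p3) == (q2, q3) :> W k.+1) = (p1 == q2) && (p3 == q3) by [].
case: (p1 =P q2) => [-> | _] /=; last by rewrite !(mul0r, mulr0).
case: (p3 =P q3) => [-> | _] /=; last by rewrite !(mul0r, mulr0).
by case: (wpar (sval p2)); case: (wpar (sval q1)); case: (wpar (sval q2));
  case: (spar q3);
  rewrite /= ?(expr0, expr1, mul1r, mulr1, mulrNN, mulN1r, opprK).
Qed.

Lemma swap0_shift k (g : opW k) :
  swap0 k * shiftop (shiftop g) = shiftop (shiftop g) * swap0 k.
Proof.
apply: shomP => -[p1 [p2 p3]] [q1 [q2 q3]]; rewrite [LHS]swap0l [RHS]swap0r.
rewrite !shiftopE /=.
case: (p1 =P q2) => [-> | _] /=; last by rewrite !(mul0r, mulr0).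
case: (p2 =P q1) => [-> | _] /=; last by rewrite !(mul0r, mulr0).
by case: (wpar (sval q1)); case: (wpar (sval q2)); case: (spar p3);
  case: (spar q3);
  rewrite /= ?(expr0, expr1, mul1r, mulr1, mulrNN, mulN1r, mulrN, mulNr, opprK).
Qed.

Fixpoint swap k (j : nat) : opW k :=
  match k return opW k with
  | 0 => 0
  | k'.+1 =>
      if j is j'.+1 then shiftop (swap k' j') else
      match k' return opW k'.+1 with 0 => 0 | k''.+1 => swap0 k'' end
  end.

Lemma swap_homog k j : homog false (swap k j : shom C _ _).
Proof.
have h0 k' : homog false (0 : shom C (W k') (W k')).
  by apply/homogP => p q _; rewrite ffunE.
elim: k j => [|k IH] [|j]; [exact: h0 | exact: h0 | |].
  by case: k {IH} => [|k]; [apply: h0 | apply: swap0_homog].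
by rewrite /= shiftop_def -(addbb false); apply: homog_tens => //; apply: homog_id.
Qed.

Lemma swap2 k j : (j.+1 < k)%N -> swap k j * swap k j = 1.
Proof.
elim: k j => [|[|k] IH] [|j] // jk; first exact: swap02.
by rewrite [swap _ _]/= -shiftopM IH // shiftop1.
Qed.

Lemma swap_site_fix e k i j (x : opV) : homog e (x : shom C _ _) ->
  (j.+1 < k)%N -> i != j -> i != j.+1 ->
  swap k j * site k i x = site k i x * swap k j.
Proof.
move=> hx; elim: k i j => [|[|k] IH] [|i] [|j] // jk ij ij1.
- by rewrite /= (shift_head hx (swap_homog k.+1 j)) andbF scale1r.
- case: i ij ij1 => // i _ _; exact: swap0_shift.
- rewrite [swap _ _]/= [site _ _ _]/= -!shiftopM; congr shiftop.
  exact: (IH i j).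
Qed.

Lemma swap_site k j (x : opV) : (j.+1 < k)%N ->
  swap k j * site k j x = site k j.+1 x * swap k j.
Proof.
elim: k j => [|[|k] IH] [|j] // jk; first exact: swap0_head.
rewrite [swap _ _]/= [site _ j.+1 _]/= [site _ j.+2 _]/= -!shiftopM.
by congr shiftop; apply: IH.
Qed.

Lemma swap_siteS k j (x : opV) : (j.+1 < k)%N ->
  swap k j * site k j.+1 x = site k j x * swap k j.
Proof.
move=> jk; rewrite -[RHS]mul1r -(swap2 jk) -!mulrA; congr (_ * _).
by rewrite [in RHS]mulrA swap_site // -mulrA swap2 // mulr1.
Qed.

End Sites.

(** * Ordered products of operators at distinct sites *)

Section OrderedProducts.
Variables (C : numClosedFieldType) (M : superspace) (I : eqType).
Implicit Types (s : seq I) (u v w : I -> op C M).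

(** Additivity in one factor of a noncommutative product. A repeated index would make the dependence
    on that factor quadratic, hence [uniq s]. *)
Lemma prod_addi s i u v w : uniq s -> i \in s -> w i = u i + v i ->
  (forall j, j != i -> u j = w j /\ v j = w j) ->
  \prod_(j <- s) w j = \prod_(j <- s) u j + \prod_(j <- s) v j.
Proof.
move=> + + wi wj; elim: s => //= j s IH /andP[js us]; rewrite inE !big_cons.
have [ij _ | ij /= si] := eqVneq i j; last first.
  have /wj[-> ->] : j != i by rewrite eq_sym.
  by rewrite (IH us si) mulrDr.
rewrite -{}ij in js *.
have li l : l \in s -> l != i by move=> ls; apply: contraTneq ls => ->.
rewrite wi mulrDl; congr (_ * _ + _ * _); rewrite !big_seq.
  by apply: eq_bigr => l /li /wj[-> _].
by apply: eq_bigr => l /li /wj[_ ->].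
Qed.

End OrderedProducts.

(** The new factor travels past those preceding [j0], and each exchange costs a sign that depends on
    parities only. So [z] can be chosen before [t], which lets [placements_rec] sum over all [t]
    with one coefficient. *)
Lemma site_insert (C : numClosedFieldType) (n k : nat) (I : eqType) (s : seq I) e
    (es : I -> bool) (x : op C (Defs.Sym n 1)) (xs : I -> op C (Defs.Sym n 1)) j0 :
  homog e (x : shom C _ _) -> (forall j, homog (es j) (xs j : shom C _ _)) ->
  uniq s -> j0 \in s ->
  exists z : C, forall t : I -> nat, {in s &, injective t} ->
    site k (t j0) x * \prod_(j <- s) site k (t j) (xs j)
    = z *: \prod_(j <- s) site k (t j) (if j == j0 then x * xs j else xs j).
Proof.
move=> hx hxs; elim: s => //= j s IH /andP[js us]; rewrite inE.
have [j0j _ | jj0 /= sj0] := eqVneq j0 j.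
  rewrite -{}j0j in js *; exists 1 => t _; rewrite !big_cons eqxx mulrA -siteM scale1r; congr (_ * _).
  by rewrite !big_seq; apply: eq_bigr => l ls; rewrite ifN //; apply: contraTneq ls => ->.
have [z Ez] := IH us sj0; exists (((-1) ^+ (e && es j)) * z) => t tI.
rewrite !big_cons mulrA eq_sym (negPf jj0).
rewrite (site_comm k hx (hxs j)); last first.
  apply: contra_neq jj0 => tjj0; apply: tI => //; rewrite inE ?eqxx ?sj0 ?orbT //.
rewrite opZl -mulrA Ez ?opZr ?scalerA //.
by move=> u v us' vs'; apply: tI; rewrite inE ?us' ?vs' orbT.
Qed.

(** * Averaging over the Sergeev algebra *)

Section Sergeev.
Variables (C : numClosedFieldType) (n k : nat).
Local Notation V := (Defs.Sym n 1).
Local Notation W := (Sob n (nseq k 1%N)).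
Local Notation opV := (op C V).
Local Notation opW := (op C W).
Implicit Types (e : bool) (x y : opV).

Variable c : opV.
Hypotheses (c_odd : homog true (c : shom C V V)) (c2 : c * c = 1).

(** As [c] is odd, the second condition is the vanishing of the superbracket of [x] and [c]. For the
    structure map of V_n these are the homogeneous elements of q(n). *)
Definition supercommutes e x : Prop :=
  homog e (x : shom C V V) /\ c * x = (-1) ^+ e *: (x * c).

Lemma homogM e e' M (x y : op C M) : homog e (x : shom C M M) ->
  homog e' (y : shom C M M) -> homog (e (+) e') (x * y : shom C M M).
Proof. by rewrite opM; apply: homog_comp. Qed.

Lemma signZK e M (x : op C M) : (-1 : C) ^+ e *: ((-1 : C) ^+ e *: x) = x.
Proof. by rewrite scalerA -expr2 sqrr_sign scale1r. Qed.

Lemma supercommutesM e e' x y :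
  supercommutes e x -> supercommutes e' y -> supercommutes (e (+) e') (x * y).
Proof.
move=> [hx cx] [hy cy]; split; first exact: homogM.
by rewrite mulrA cx opZl -mulrA cy opZr scalerA mulrA signr_addb.
Qed.

(** Since [c * c = 1], both sides of the relation expand to [c * x + (-1) ^+ e *: (x * c)]. *)
Lemma supercommutes_avg e x : homog e (x : shom C V V) ->
  supercommutes e (x + (-1) ^+ e *: (c * x * c)).
Proof.
move=> hx; split.
  apply: (homogD hx); apply: homogZ.
  rewrite -(addbK true e) (addbC e) ; apply: homogM => //; exact: homogM.
rewrite mulrDr mulrDl scalerDr opZr opZl signZK addrC !mulrA c2 mul1r.
by rewrite -!mulrA c2 mulr1.
Qed.

Let G : opW := parity_op C W.
(** [site k i c] and [G] both anticommute with odd operators at other sites, so their product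
    commutes with them. For [i < k] this product squares to -1, whence the inverse [- clifford i]
    below. *)
Definition clifford (i : nat) : opW := site k i c * G.

Lemma clifford_site_fix e i j x : homog e (x : shom C V V) -> i != j ->
  clifford i * site k j x = site k j x * clifford i.
Proof.
move=> hx ij; rewrite /clifford -mulrA (parity_op_comm (site_homog k j hx)) opZr.
by rewrite mulrA (site_comm k c_odd hx ij) opZl signZK mulrA.
Qed.

Lemma clifford_site e i x : homog e (x : shom C V V) ->
  clifford i * site k i x * - clifford i = site k i ((-1) ^+ e *: (c * x * c)).
Proof.
move=> hx; rewrite /clifford mulrN -!mulrA.
rewrite [G * _]mulrA (parity_op_comm (site_homog k i hx)) opZl opZr.
rewrite -(mulrA _ G) (mulrA G) (parity_op_comm (site_homog k i c_odd)).
by rewrite expr1 scaleN1r mulNr -mulrA parity_op2 mulr1 !mulrN scalerN opprK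
  siteZ !siteM mulrA.
Qed.

Lemma cliffordK i : (i < k)%N -> clifford i * - clifford i = 1.
Proof.
move=> ik; have := clifford_site i (@homog_id C V); rewrite expr0 scale1r.
by rewrite [sid C V](_ : _ = 1 :> opV) // site1 // !mulr1 c2 site1.
Qed.

Definition clifford_avg i (X : opW) : opW := X + clifford i * X * - clifford i.

Lemma conj_prod (I : Type) (s : seq I) (a b : opW) (u : I -> opW) : a * b = 1 ->
  b * a = 1 -> a * (\prod_(j <- s) u j) * b = \prod_(j <- s) (a * u j * b).
Proof.
move=> ab ba; apply: (big_morph (fun X => a * X * b)) => [X Y|]; last by rewrite mulr1.
by rewrite !mulrA -(mulrA _ b) ba mulr1.
Qed.

Definition symm e x : opV := x + (-1) ^+ e *: (c * x * c).

(** Conjugation by [clifford i] is multiplicative and alters only the factor at site [i]; adding it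
    to the identity symmetrises exactly that factor. *)
Lemma clifford_avg_prod i (x : nat -> opV) (e : nat -> bool) : (i < k)%N ->
  (forall j, homog (e j) (x j : shom C V V)) ->
  clifford_avg i (\prod_(j < k) site k j (x j))
  = \prod_(j < k) site k j (if j == i :> nat then symm (e j) (x j) else x j).
Proof.
move=> ik hx; rewrite /clifford_avg conj_prod ?cliffordK //; last first.
  by rewrite mulNr -mulrN cliffordK.
apply/esym/(@prod_addi _ _ _ _ (Ordinal ik)).
- exact: index_enum_uniq.
- exact: mem_index_enum.
- by rewrite /= eqxx siteD (clifford_site _ (hx i)).
- move=> j ji; have jiE : (j == i :> nat) = false by apply/negbTE.
  rewrite jiE; split=> //; rewrite (clifford_site_fix (hx j)) 1?eq_sym ?jiE //.
  by rewrite -mulrA cliffordK // mulr1.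
Qed.

Definition clifford_avgs (s : seq nat) : opW -> opW :=
  foldr (fun i F => clifford_avg i \o F) id s.

Lemma clifford_avgs_prod s (x : nat -> opV) (e : nat -> bool) : uniq s ->
  (forall i, i \in s -> (i < k)%N) -> (forall j, homog (e j) (x j : shom C V V)) ->
  clifford_avgs s (\prod_(j < k) site k j (x j))
  = \prod_(j < k) site k j (if (j : nat) \in s then symm (e j) (x j) else x j).
Proof.
move=> + + hx; elim: s => [|i s IH] //= /andP[si us] sk.
rewrite IH //; last by move=> j js; rewrite sk // inE js orbT.
pose x' j := if j \in s then symm (e j) (x j) else x j.
have hx' j : homog (e j) (x' j : shom C V V).
  by rewrite /x'; case: ifP => // _; case: (supercommutes_avg (hx j)).
rewrite (clifford_avg_prod _ hx') ?sk ?inE ?eqxx //.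
apply: eq_bigr => j _; rewrite /x' inE.
by case: eqP => [-> | //]; rewrite (negPf si).
Qed.

(** * Averages with coefficients in an algebra containing the Sergeev generators *)

Variable A : opW -> Prop.
Hypotheses (A1 : A 1) (AD : forall X Y, A X -> A Y -> A (X + Y))
  (AZ : forall a X, A X -> A (a *: X)) (AM : forall X Y, A X -> A Y -> A (X * Y)).
Hypotheses (A_clifford : forall i, (i < k)%N -> A (clifford i))
  (A_swap : forall j, (j.+1 < k)%N -> A (swap C n k j)).

Lemma averaging_clifford s : (forall i, i \in s -> (i < k)%N) ->
  averaging A (clifford_avgs s).
Proof.
elim: s => [_|i s IH sk] /=.
  exists [:: (1, 1)], 1; first exact: oner_neq0.
  split=> [p | |X]; rewrite ?big_seq1 /=; first by rewrite inE => /eqP->.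
    by rewrite mulr1 scale1r.
  by rewrite mul1r mulr1.
apply: averaging_comp => //; last by apply: IH => j js; rewrite sk // inE js orbT.
have ik : (i < k)%N by rewrite sk // inE eqxx.
have AN : A (- clifford i) by rewrite -scaleN1r; apply/AZ/A_clifford.
(* The constant is 1 + 1: both pairs consist of mutually inverse operators. *)
exists [:: (1, 1); (clifford i, - clifford i)], 2; first by rewrite pnatr_eq0.
split=> [p | |X].
- rewrite !inE; case/orP=> /eqP-> //; split=> //; exact: A_clifford.
- by rewrite big_cons big_seq1 /= mulr1 cliffordK // -[2]/(1 + 1) scalerDl !scale1r.
- by rewrite big_cons big_seq1 /= mul1r mulr1.
Qed.

(** The average needs such a pair for each [s] separately, so no braid relation is verified and no
    representation of the symmetric group is constructed. *)
Definition intertwiner (s : 'S_k) (ab : opW * opW) : Prop :=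
  [/\ A ab.1, A ab.2, ab.1 * ab.2 = 1, ab.2 * ab.1 = 1 &
   forall e x (i : 'I_k), homog e (x : shom C V V) ->
     ab.1 * site k i x * ab.2 = site k (s i) x].

Lemma intertwinerM s t ab ab' : intertwiner s ab -> intertwiner t ab' ->
  intertwiner (s * t)%g (ab'.1 * ab.1, ab.2 * ab'.2).
Proof.
move=> [Aa Ab ab1 ba1 H] [Aa' Ab' ab1' ba1' H']; split; try exact: AM.
- by rewrite /= mulrA -(mulrA ab'.1) ab1 mulr1.
- by rewrite /= mulrA -(mulrA ab.2) ba1' mulr1.
- move=> e x i hx; rewrite permM -(H' _ _ _ hx) -(H _ _ _ hx) /=.
  by rewrite !mulrA.
Qed.

Lemma intertwiner_tpermS (i j : 'I_k) : j = i.+1 :> nat ->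
  intertwiner (tperm i j) (swap C n k i, swap C n k i).
Proof.
move=> ji; have ik : (i.+1 < k)%N by rewrite -ji.
split; rewrite /= ?swap2 //; try exact: A_swap.
move=> e x l hx; case: tpermP => [->|->|li lj].
- by rewrite swap_site // -mulrA swap2 // mulr1 ji.
- by rewrite ji swap_siteS // -mulrA swap2 // mulr1.
- rewrite (swap_site_fix hx) //; first by rewrite -mulrA swap2 // mulr1.
    by apply/eqP => /val_inj.
  by rewrite -ji; apply/eqP => /val_inj.
Qed.

(** [swap] supplies the adjacent transpositions, [tp] the others by induction on the distance [d],
    and these generate. *)
Lemma intertwiner_perm (s : 'S_k) : exists ab, intertwiner s ab.
Proof.
have tp d : forall i j : 'I_k, j = (i + d)%N :> nat ->
    exists ab, intertwiner (tperm i j) ab.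
  elim: d => [|d IH] i j ijd.
    have -> : i = j by apply: val_inj; rewrite /= ijd addn0.
    rewrite tperm1; exists (1, 1).
    by split=> //=; rewrite ?mulr1 // => e x l _; rewrite mul1r mulr1 perm1.
  have lk : (i + d < k)%N by rewrite (leq_trans _ (ltn_ord j)) // ijd addnS.
  pose l := Ordinal lk.
  have [ab Hab] := IH i l (erefl _).
  have jl : j = l.+1 :> nat by rewrite ijd addnS.
  (* If [d = 0] the pair is already adjacent; the conjugation formula below requires [i] and [l] to
     be distinct. *)
  have [d0 | d0] := posnP d.
    have il : i = l by apply: val_inj; rewrite /= d0 addn0.
    by exists (swap C n k i, swap C n k i); apply: intertwiner_tpermS; rewrite il.
  have -> : tperm i j = (tperm l j * tperm i l * tperm l j)%g.
    rewrite -{1}[tperm l j]tpermV -mulgA -/(conjg _ _) tpermJ tpermL tpermD //.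
      by rewrite -val_eqE /= -{2}[val i]addn0 eqn_add2l -lt0n.
    by rewrite -val_eqE /= ijd -{2}[val i]addn0 eqn_add2l.
  have Hl := intertwiner_tpermS jl.
  by eexists; exact: (intertwinerM (intertwinerM Hl Hab) Hl).
have [ts -> _] := prod_tpermP s.
elim/big_rec: _ => [|t u _ [ab Hab]].
  by exists (1, 1); split=> //=; rewrite ?mulr1 // => e x l _; rewrite mul1r mulr1 perm1.
suff [ab' Hab'] : exists ab, intertwiner (tperm t.1 t.2) ab.
  by eexists; exact: (intertwinerM Hab' Hab).
have [ij | /ltnW ji] := leqP t.1 t.2.
  by apply: (tp (t.2 - t.1)%N); rewrite subnKC.
by rewrite tpermC; apply: (tp (t.1 - t.2)%N); rewrite subnKC.
Qed.

Lemma averaging_perm : exists2 F : opW -> opW, averaging A F &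
  forall (x : nat -> opV) (e : nat -> bool),
    (forall j, homog (e j) (x j : shom C V V)) ->
    F (\prod_(j < k) site k j (x j))
    = \sum_(s : 'S_k) \prod_(j < k) site k (s j) (x j).
Proof.
have [ab Hab] := fin_all_exists intertwiner_perm.
exists (fun X => \sum_(s : 'S_k) (ab s).1 * X * (ab s).2).
  exists [seq ab s | s <- index_enum {perm 'I_k}], #|{perm 'I_k}|%:R.
    rewrite pnatr_eq0 -lt0n; apply/card_gt0P; by exists 1%g.
  split=> [p /mapP[s _ ->] | |X].
  - by case: (Hab s).
  - rewrite big_map (eq_bigr (fun=> 1)) => [|s _]; last by case: (Hab s).
    by rewrite sumr_const scaler_nat.
  - by rewrite big_map.
move=> x e hx; apply: eq_bigr => s _; case: (Hab s) => _ _ ab1 ba1 H.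
by rewrite conj_prod //; apply: eq_bigr => j _; apply: H (hx j).
Qed.

(** * Placements at distinct sites and their commutation with [f] *)

Variable f : opW.
Hypothesis f_comm : forall e x, supercommutes e x ->
  f * (\sum_(i < k) site k i x) = (\sum_(i < k) site k i x) * f.

(** For [r = 1] this is the action of one element on the tensor power, for [r = k] the average over
    permutations; the values in between serve the induction. *)
Definition placements r (xs : 'I_r -> opV) : opW :=
  \sum_(t : r.-tuple 'I_k | uniq t) \prod_(j < r) site k (tnth t j) (xs j).

(** In the product of the sum over all sites with a placement of the last [r] elements, the new site
    is either free, which gives [placements xs], or occupied by the [j]-th of these elements, and
    then the two merge into one product at the cost of [z j]. *)
Lemma placements_rec r (es : 'I_r.+1 -> bool) (xs : 'I_r.+1 -> opV) :
  (forall j, homog (es j) (xs j : shom C V V)) ->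
  exists z : 'I_r -> C,
    placements xs
    = (\sum_(i < k) site k i (xs ord0)) * placements (fun j => xs (lift ord0 j))
      - \sum_(j < r) z j *: placements (fun l =>
          if l == j then xs ord0 * xs (lift ord0 l) else xs (lift ord0 l)).
Proof.
move=> hxs; pose xs' j := xs (lift ord0 j).
have [z Hz] : exists z : 'I_r -> C, forall j (t : r.-tuple 'I_k), uniq t ->
    site k (tnth t j) (xs ord0) * \prod_(l < r) site k (tnth t l) (xs' l)
    = z j *: \prod_(l < r) site k (tnth t l)
               (if l == j then xs ord0 * xs' l else xs' l).
  suff H j : exists z : C, forall t : r.-tuple 'I_k, uniq t ->
      site k (tnth t j) (xs ord0) * \prod_(l < r) site k (tnth t l) (xs' l)
      = z *: \prod_(l < r) site k (tnth t l) (if l == j then xs ord0 * xs' l else xs' l).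
    exact: (fin_all_exists H).
  have [z Hz] := @site_insert C n k _ (index_enum 'I_r) _ _ _ xs' j (hxs ord0)
    (fun j => hxs (lift ord0 j)) (index_enum_uniq _) (mem_index_enum _).
  exists z => t ut; apply: (Hz (fun l => tnth t l)) => u v _ _ /val_inj.
  by move/tuple_uniqP: ut; apply.
exists z; apply/eqP; rewrite eq_sym subr_eq; apply/eqP.
pose T (i : 'I_k) (t : r.-tuple 'I_k) :=
  site k i (xs ord0) * \prod_(l < r) site k (tnth t l) (xs' l).
have -> : (\sum_(i < k) site k i (xs ord0)) * placements xs'
    = \sum_(t : r.-tuple 'I_k | uniq t) \sum_(i < k) T i t.
  rewrite mulr_sumr; apply: eq_bigr => t _; exact: mulr_suml.
have -> : placements xs
    = \sum_(t : r.-tuple 'I_k | uniq t) \sum_(i < k | i \notin t) T i t.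
  rewrite /placements (reindex (fun p : r.-tuple 'I_k * 'I_k => cons_tuple p.2 p.1)) /=.
    rewrite pair_big_dep; apply: eq_big => [[t i] /=|[t i] _]; first by rewrite andbC.
    rewrite big_ord_recl tnth0; congr (_ * _).
    by apply: eq_bigr => l _; rewrite tnthS.
  exists (fun t : r.+1.-tuple 'I_k => (behead_tuple t, thead t)) => [[t i] _ | t _] /=.
    by congr (_, _); apply: val_inj.
  by rewrite [RHS]tuple_eta; apply: val_inj.
under [in X in _ + X]eq_bigr => j _ do rewrite scaler_sumr.
rewrite [X in _ + X]exchange_big -big_split; apply: eq_bigr => t ut /=.
rewrite (bigID (fun i => i \in (t : seq _))) addrC /=; congr (_ + _).
rewrite -big_uniq // big_tuple; apply: eq_bigr => j _.
exact: Hz.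
Qed.

(** The merged products still supercommute with [c], so the correction terms of [placements_rec]
    fall under the induction hypothesis. *)
Lemma placements_comm r (es : 'I_r -> bool) (xs : 'I_r -> opV) :
  (forall j, supercommutes (es j) (xs j)) -> f * placements xs = placements xs * f.
Proof.
elim: r es xs => [|r IH] es xs Hxs.
  rewrite /placements (big_pred1 [tuple]) => [|t]; last by rewrite tuple0.
  by rewrite big_ord0 mulr1 mul1r.
have [z ->] := placements_rec (fun j => (Hxs j).1).
rewrite mulrBr mulrBl mulrA (f_comm (Hxs ord0)) -!mulrA.
rewrite (IH _ _ (fun j => Hxs (lift ord0 j))); congr (_ - _).
rewrite mulr_sumr mulr_suml; apply: eq_bigr => j _; rewrite opZr opZl; congr (_ *: _).
apply: (IH (fun l => if l == j then es ord0 (+) es (lift ord0 l) else es (lift ord0 l))).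
by move=> l; case: eqP => // _; apply: supercommutesM.
Qed.

Lemma sum_perm_placements (x : nat -> opV) :
  \sum_(s : 'S_k) \prod_(j < k) site k (s j) (x j)
  = placements (fun j : 'I_k => x j).
Proof.
rewrite /placements (reindex (fun s : 'S_k => [tuple s j | j < k])).
  apply: eq_big => [s | s _]; last first.
    by apply: eq_bigr => j _; rewrite tnth_mktuple.
  apply/esym/tuple_uniqP => u v; rewrite !tnth_mktuple; exact: perm_inj.
(* The default [1%g] is never taken, as the tuples of the sum are injective. *)
exists (fun t : k.-tuple 'I_k => @insubd _ _ {perm 'I_k} 1%g [ffun j => tnth t j]).
  move=> s _; rewrite (_ : [ffun j => _] = val s) ?valKd //.
  by apply/ffunP => j; rewrite ffunE tnth_mktuple -[RHS]/(pval s j) pvalE.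
move=> t; rewrite inE => /tuple_uniqP tI; apply: eq_from_tnth => j.
rewrite tnth_mktuple -pvalE -[pval _]/(val _) insubdK ?ffunE //.
by apply/injectiveP => u v; rewrite !ffunE => /tI.
Qed.

(** Commutation with the averages is linear in [X], so matrix units suffice. Each is a multiple of a
    product of site operators, and its average is a multiple of a placement of symmetrised
    elements. *)
Theorem double_commutant_sergeev : A f.
Proof.
have [F avF EF] := averaging_perm.
have sk i : i \in iota 0 k -> (i < k)%N by rewrite mem_iota.
have av := averaging_comp AM avF (averaging_clifford sk).
apply: (double_commutant A1 AD AZ AM av).
have [s [N _ [_ _ sE]]] := av.
have unit_comm p q : f * (F \o clifford_avgs (iota 0 k)) (unit_op C p q)
    = (F \o clifford_avgs (iota 0 k)) (unit_op C p q) * f.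
  have [x [e [a hx ->]]] := unit_op_sites C p q.
  have hx' j : homog (e j) (symm (e j) (x j) : shom C V V).
    by case: (supercommutes_avg (hx j)).
  have -> : (F \o clifford_avgs (iota 0 k)) (a *: \prod_(i < k) site k i (x i))
      = a *: placements (fun j : 'I_k => symm (e j) (x j)).
    transitivity (a *: (F \o clifford_avgs (iota 0 k)) (\prod_(i < k) site k i (x i))).
      by rewrite !sE scaler_sumr; apply: eq_bigr => p' _; rewrite opZr opZl.
    rewrite /= (clifford_avgs_prod (iota_uniq 0 k) sk hx).
    under eq_bigr => j _ do rewrite mem_iota ltn_ord.
    by rewrite (EF _ _ hx') (sum_perm_placements (fun j => symm (e j) (x j))).
  rewrite opZr opZl; congr (_ *: _).
  apply: (@placements_comm _ (fun j => e j)) => j; exact: supercommutes_avg.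
move=> X; rewrite [X]op_unitE.
suff -> : (F \o clifford_avgs (iota 0 k))
      (\sum_r (X : shom C W W) r *: unit_op C r.1 r.2)
    = \sum_r (X : shom C W W) r *: (F \o clifford_avgs (iota 0 k)) (unit_op C r.1 r.2).
  rewrite mulr_sumr mulr_suml; apply: eq_bigr => r _.
  by rewrite opZr opZl unit_comm.
rewrite sE.
under eq_bigr => p _ do rewrite mulr_sumr mulr_suml.
rewrite exchange_big; apply: eq_bigr => r _ /=.
rewrite -[F _]/((F \o clifford_avgs (iota 0 k)) _) sE scaler_sumr.
by apply: eq_bigr => p _; rewrite opZr opZl.
Qed.

End Sergeev.

(** * The natural module as the thin strand *)

Section NaturalModule.
Variables (C : numClosedFieldType) (n : nat).
Local Notation V := (Defs.Sym n 1).
Local Notation W k := (Sob n (nseq k 1%N)).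
Local Notation opV := (op C V).
Local Notation opW k := (op C (W k)).
Local Notation gl := (gl C n).

Definition mono (l : letter n) : mon n 1 :=
  exist (fun w : 1.-tuple (letter n) => sorted (@mrel n) w) [tuple l] isT.
Definition lett (m : mon n 1) : letter n := tnth (val m) ord0.

Lemma monoK : cancel mono lett.
Proof. by []. Qed.

Lemma val_mon1 (m : mon n 1) : val m = [tuple lett m].
Proof. by apply: eq_from_tnth => i; rewrite ord1 /lett (tnth_nth (lett m)). Qed.

Lemma lettK : cancel lett mono.
Proof. by move=> m; apply: val_inj; rewrite [RHS]val_mon1. Qed.

Lemma spar_mon1 (m : mon n 1) : spar (m : V) = (lett m).2.
Proof. by rewrite /= val_mon1 /wpar /= addn0; case: (_.2). Qed.

Lemma symw1E (l : letter n) (m : mon n 1) : symw C 1 [:: l] m = (lett m == l)%:R.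
Proof.
rewrite ffunE (_ : winv [:: l] = 0%N) // expr0.
have -> : perm_eq (val m) [:: l] = (lett m == l).
  rewrite val_mon1 /=; apply/idP/eqP => [/perm_small_eq|->]; last exact: perm_refl.
  by move=> /(_ isT) [].
by case: eqP.
Qed.

Definition gl_op (x : gl) : opV := [ffun r => x (lett r.1, lett r.2)].
Definition op_gl (x : opV) : gl := [ffun r => (x : shom C V V) (mono r.1, mono r.2)].

Lemma gl_opE (x : gl) p q : (gl_op x : shom C V V) (p, q) = x (lett p, lett q).
Proof. by rewrite ffunE. Qed.

Lemma op_glK (x : opV) : gl_op (op_gl x) = x.
Proof. by apply: shomP => p q; rewrite !ffunE /= !lettK. Qed.

Lemma op_glE (x : opV) p q : op_gl x (p, q) = (x : shom C V V) (mono p, mono q).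
Proof. by rewrite ffunE. Qed.

Lemma sum_mono (F : mon n 1 -> C) : \sum_m F m = \sum_l F (mono l).
Proof. by apply: reindex; exists lett => ? _; [apply: monoK | apply: lettK]. Qed.

Lemma gl_opM (x y : gl) : gl_op (scomp x y) = gl_op x * gl_op y.
Proof.
apply: shomP => p q; rewrite gl_opE opME scompE sum_mono.
by apply: eq_bigr => l _; rewrite !gl_opE monoK.
Qed.

Lemma gl_opZ a (x : gl) : gl_op (a *: x) = a *: gl_op x.
Proof. by apply/ffunP => r; rewrite !ffunE. Qed.

Lemma homog_op_gl e (x : opV) : homog e (x : shom C V V) -> homog e (op_gl x).
Proof.
move=> /homogP hx; apply/homogP => p q pq.
by rewrite op_glE; apply: hx; rewrite !spar_mon1 !monoK.
Qed.

Definition cop : opV := gl_op (cV C n).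

Lemma cop_odd : homog true (cop : shom C V V).
Proof.
apply/homogP => p q; rewrite gl_opE !spar_mon1 ffunE /=; case: (lett p =P _) => // -> /=.
by case: (lett q).2.
Qed.

Lemma cop2 : cop * cop = 1.
Proof.
apply: shomP => p q; rewrite opME sum_mono (bigD1 (bar (lett q))) //= big1 => [|l lq].
  rewrite !gl_opE !ffunE /= monoK eqxx addr0 /bar /= negbK -surjective_pairing.
  rewrite -(can_eq lettK); case: eqP => _; last by rewrite mul0r.
  rewrite mulrACA -expr2 sqrCi; case: (_.2); rewrite /= ?expr0 ?expr1.
    by rewrite mul1r mulrNN mulr1.
  by rewrite mulr1 mulrNN mulr1.
by rewrite !gl_opE !ffunE /= !monoK (negPf lq) mulr0.
Qed.

Lemma op_gl_q_mem e (x : opV) : supercommutes cop e x -> q_mem (op_gl x).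
Proof.
move=> [hx cx]; have hg := homog_op_gl hx; have hc : homog true (cV C n).
  have := homog_op_gl cop_odd; congr (homog _ _).
  by apply/shomP => p q; rewrite op_glE gl_opE.
rewrite /q_mem (sbracket_homog hg hc) andbT.
apply/eqP; rewrite subr_eq0; apply/eqP.
suff E : gl_op (scomp (op_gl x) (cV C n)) = gl_op ((-1) ^+ e *: scomp (cV C n) (op_gl x)).
  apply: shomP => p q; have := congr1 (fun y : opV => (y : shom C V V) (mono p, mono q)) E.
  by rewrite !gl_opE !monoK.
rewrite gl_opM op_glK.
by rewrite gl_opZ gl_opM op_glK -/cop cx signZK.
Qed.

Lemma act_Sym1 (x : gl) : act_Sym 1 x = gl_op x.
Proof.
apply: shomP => p q; rewrite gl_opE ffunE /derw /= big_ord1 sum_ffunE.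
have ZE a (v : svec C V) m : (a *: v) m = a * v m by rewrite ffunE.
rewrite (bigD1 (lett p)) //= big1 => [|l lp].
  rewrite addr0 ZE take0 andbF expr0 mul1r val_mon1 symw1E eqxx.
  by rewrite mulr1.
by rewrite ZE take0 val_mon1 symw1E (eq_sym (lett p)) (negPf lp) mulr0.
Qed.

(** Links the module action to the sums over sites that appear in the hypothesis on [f]. *)
Lemma act_sites k (x : gl) :
  Defs.act (nseq k 1%N) x = \sum_(i < k) site k i (gl_op x) :> opW k.
Proof.
elim: k => [|k IH]; first by rewrite big_ord0.
rewrite big_ord_recl /= act_Sym1 headop_def; congr (_ + _).
rewrite [X in stensm _ X]IH -shiftop_def.
apply: (big_morph (@shiftop C n k) (@shiftopD _ _ _)).
by rewrite -(scale0r (0 : opW k)) shiftopZ scale0r.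
Qed.

Lemma stenso_shift k (g : opW k) :
  stenso (a := [:: 1%N]) (b := [:: 1%N]) (sid C (Sob n [:: 1%N])) g = shiftop g.
Proof.
apply: shomP => -[p p'] [q q']; rewrite shiftopE ffunE stensmE sidE /= addbF.
by have -> : ((p, tt) == (q, tt) :> Sob n [:: 1%N]) = (p == q) by rewrite xpair_eqE andbT.
Qed.

Lemma stenso_head k (f : shom C (Sob n [:: 1%N]) (Sob n [:: 1%N])) (x : opV) :
  (forall p q, f ((p, tt), (q, tt)) = (x : shom C V V) (p, q)) ->
  stenso f (sid C (W k)) = headop k x.
Proof.
move=> fx; apply: shomP => -[p p'] [q q'].
by rewrite headopE ffunE stensmE sidE fx /= addbF.
Qed.

Lemma stenso_swap k (f : shom C (Sob n [:: 1%N; 1%N]) (Sob n [:: 1%N; 1%N])) :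
  (forall p1 p2 q1 q2, f ((p1, (p2, tt)), (q1, (q2, tt)))
     = ((p1 == q2) && (p2 == q1))%:R * (-1) ^+ (spar (q1 : V) && spar (q2 : V))) ->
  stenso f (sid C (W k)) = swap0 C n k.
Proof.
move=> fx; apply: shomP => -[p1 [p2 p3]] [q1 [q2 q3]].
rewrite ffunE stensmE sidE fx ffunE /= andbA.
case: (p3 =P q3) => [-> | _]; last by rewrite andbF !(mulr0, mul0r).
by rewrite addbb expr0 mul1r mulr1 andbT.
Qed.

End NaturalModule.

Lemma typed_wobj (C : numClosedFieldType) a b (t : term C) :
  typed a b t -> wobj a /\ wobj b.
Proof.
rewrite /wobj; elim=> //.
- by case.
- by case=> [|k] [|l].
- by case=> [|k] [|l].
- by move=> a' b' c t' u _ [_ hc] _ [ha _].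
- by move=> a' b' c d t' u _ [ha hb] _ [hc hd]; rewrite !mem_cat !negb_or ha hb hc hd.
Qed.

Lemma scale_stenso (C : numClosedFieldType) n a b a' b' z z'
    (f : shom C (Sob n a) (Sob n b)) (g : shom C (Sob n a') (Sob n b')) :
  stenso (z *: f) (z' *: g) = (z * z') *: stenso f g.
Proof.
apply/ffunP => p; rewrite [LHS]ffunE stensmZl stensmZr scalerA [LHS]ffunE [RHS]ffunE.
by congr (_ *: _); rewrite [RHS]ffunE.
Qed.

(** * Reduction to thin strands *)

Section Retracts.
Variables (C : numClosedFieldType) (n : nat) (Psi : superfunctor C n).
Implicit Types (a b c d : seq nat) (t u : term C).

(** A nonzero scalar stands in for 1 because the digon relation yields binomial coefficients. Even
    webs are required so that tensoring and composing introduce no signs. *)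
Definition retract a b : Prop :=
  exists t u, exists2 N : C, N != 0 &
  [/\ typed a b t, typed b a u, tpar false t, tpar false u
    & scomp (Psi a b t) (Psi b a u) = N *: sid C (Sob n b)].

Lemma retract_refl a : wobj a -> retract a a.
Proof.
move=> wa; exists (Tid a), (Tid a), 1; first exact: oner_neq0.
split; try by constructor.
by rewrite fmap_id // scomp1l scale1r.
Qed.

Lemma retract_trans a b c : retract a b -> retract b c -> retract a c.
Proof.
move=> [t [u [N N0 [tt tu pt pu E]]]] [t' [u' [N' N'0 [tt' tu' pt' pu' E']]]].
exists (Tcomp t' t), (Tcomp u u'), (N * N'); first by rewrite mulf_neq0.
split; [exact: ty_comp tt' tt | exact: ty_comp tu tu'
  | exact: par_comp pt' pt | exact: par_comp pu pu' |].
rewrite (fmap_comp _ tt' tt) (fmap_comp _ tu tu').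
by rewrite -scompA (scompA (Psi a b t)) E scompZl scomp1l scompZr E' scalerA.
Qed.

Lemma retract_tens a b c d : retract a b -> retract c d -> retract (a ++ c) (b ++ d).
Proof.
move=> [t [u [N N0 [tt tu pt pu E]]]] [t' [u' [N' N'0 [tt' tu' pt' pu' E']]]].
have [_ wb] := typed_wobj tt; have [_ wd] := typed_wobj tt'.
exists (Ttens t t'), (Ttens u u'), (N * N'); first by rewrite mulf_neq0.
split; [exact: ty_tens tt tt' | exact: ty_tens tu tu'
  | exact: par_tens pt pt' | exact: par_tens pu pu' |].
have tc := ty_comp tt tu; have tc' := ty_comp tt' tu'.
(* The interchange law is applied to webs and transported by the functor, instead of being proved
   for [stenso]. *)
have wI : weq (b ++ d) (b ++ d) (Tcomp (Ttens t t') (Ttens u u'))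
    (Tscale ((-1) ^+ (false && false)) (Ttens (Tcomp t u) (Tcomp t' u'))).
  apply: weq_smc; first exact: smc_interchange.
    exact: ty_comp (ty_tens tt tt') (ty_tens tu tu').
  by apply: ty_scale; apply: ty_tens.
rewrite -(fmap_comp _ (ty_tens tt tt') (ty_tens tu tu')) (fmap_weq _ wI).
rewrite fmap_scale ?scale1r; last exact: ty_tens.
rewrite (fmap_tens _ tc tc') (fmap_comp _ tt tu) (fmap_comp _ tt' tu') E E'.
rewrite scale_stenso; congr (_ *: _).
rewrite -(fmap_id Psi wb) -(fmap_id Psi wd) -fmap_tens; try exact: ty_id.
have wI' : weq (b ++ d) (b ++ d) (Ttens (Tid b) (Tid d)) (Tid (b ++ d) : term C).
  apply: weq_smc; first exact: smc_tensid.
    by apply: ty_tens; apply: ty_id.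
  by apply: ty_id; rewrite /wobj mem_cat negb_or; apply/andP.
rewrite (fmap_weq _ wI') fmap_id //.
by rewrite /wobj mem_cat negb_or; apply/andP.
Qed.

Lemma retract_digon k l : (0 < k)%N -> (0 < l)%N -> retract [:: k; l] [:: (k + l)%N].
Proof.
move=> k0 l0; exists (Tmerge k l), (Tsplit k l), 'C(k + l, l)%:R.
  by rewrite pnatr_eq0 -lt0n bin_gt0 leq_addl.
have kl0 : (0 < k + l)%N by rewrite addn_gt0 k0.
split; try by constructor.
have wkl : wobj [:: (k + l)%N] by rewrite /wobj inE eq_sym -lt0n.
have w : weq [:: (k + l)%N] [:: (k + l)%N] (Tcomp (Tmerge k l) (Tsplit k l))
    (Tscale 'C(k + l, l)%:R (Tid [:: (k + l)%N]) : term C).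
  apply: weq_web.
  - have := rel_digon C k l; rewrite /mergek /splitk /idk /up.
    by rewrite !gtn_eqF //; case: (k + l)%N kl0.
  - by apply: (@ty_comp _ _ [:: k; l]); constructor.
  - by do 2!constructor.
rewrite -fmap_comp; try by constructor.
rewrite (fmap_weq _ w) fmap_scale ?fmap_id //; by constructor.
Qed.

Lemma wobj_ones k : wobj (nseq k 1%N).
Proof. by rewrite /wobj mem_nseq andbF. Qed.

(** One thin strand is split off at a time; the accumulated scalar is k!. *)
Lemma retract_thick k : (0 < k)%N -> retract (nseq k 1%N) [:: k].
Proof.
case: k => // k _; elim: k => [|k IH]; first exact: retract_refl.
apply: (@retract_trans _ [:: 1%N; k.+1]); last exact: (@retract_digon 1 k.+1).
apply: (@retract_tens [:: 1%N] [:: 1%N] (nseq k.+1 1%N) [:: k.+1]) => //.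
exact: retract_refl.
Qed.

Lemma retract_ones a : wobj a -> retract (nseq (sumn a) 1%N) a.
Proof.
elim: a => [_ | k a IH]; first exact: retract_refl.
rewrite /wobj inE negb_or eq_sym -lt0n => /andP[k0 wa].
rewrite /= nseqD -cat1s; apply: retract_tens (IH wa); exact: retract_thick.
Qed.

End Retracts.

(** * Fullness *)

Section Fullness.
Variables (C : numClosedFieldType) (n : nat) (Psi : superfunctor C n).
Hypothesis hPsi : is_Psi Psi.
Local Notation V := (Defs.Sym n 1).
Local Notation W k := (Sob n (nseq k 1%N)).
Local Notation opV := (op C V).
Local Notation opW k := (op C (W k)).

Definition web_image k (X : opW k) : Prop :=
  exists2 t : term C, typed (nseq k 1%N) (nseq k 1%N) t & Psi _ _ t = X.

Lemma web_image1 k : web_image (1 : opW k).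
Proof.
exists (Tid (nseq k 1%N)); first by apply/ty_id/wobj_ones.
by rewrite fmap_id // wobj_ones.
Qed.

Lemma web_imageD k (X Y : opW k) : web_image X -> web_image Y -> web_image (X + Y).
Proof.
move=> [t tt <-] [u tu <-]; exists (Tadd t u); first exact: ty_add.
exact: fmap_add.
Qed.

Lemma web_imageZ k a (X : opW k) : web_image X -> web_image (a *: X).
Proof. by move=> [t tt <-]; exists (Tscale a t); [apply: ty_scale | apply: fmap_scale]. Qed.

Lemma web_imageM k (X Y : opW k) : web_image X -> web_image Y -> web_image (X * Y).
Proof.
move=> [t tt <-] [u tu <-]; exists (Tcomp t u); first exact: ty_comp tt tu.
by rewrite opM; apply: fmap_comp.
Qed.

Lemma web_image_shift k (X : opW k) : web_image X -> web_image (shiftop X).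
Proof.
move=> [t tt <-]; have t1 : typed [:: 1%N] [:: 1%N] (Tid [:: 1%N] : term C) by constructor.
exists (Ttens (Tid [:: 1%N]) t); first exact: (ty_tens t1 tt).
rewrite -stenso_shift -(@fmap_id _ _ Psi [:: 1%N]) //.
exact: (fmap_tens Psi t1 tt).
Qed.

Lemma pure1E (l : letter n) p :
  pure C [:: 1%N] [:: [:: l]] (p, tt) = (p == mono l)%:R.
Proof.
by rewrite [LHS]ffunE /= [X in _ * X]ffunE mulr1 symw1E -(can_eq (@lettK n)) monoK.
Qed.

Lemma sapp_pure1 a (f : shom C (Sob n [:: 1%N]) (Sob n a)) (q : V) p :
  sapp f (pure C [:: 1%N] [:: [:: lett q]]) p = f (p, (q, tt)).
Proof.
rewrite ffunE (bigD1 ((q, tt) : Sob n [:: 1%N])) //= big1 => [|[q' []] qq'].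
  by rewrite pure1E lettK eqxx mulr1 addr0.
rewrite pure1E lettK; case: (q' =P q) => [E|]; last by rewrite mulr0.
by rewrite E eqxx in qq'.
Qed.

Lemma Psi_dot1 p q : Psi [:: 1%N] [:: 1%N] (Tdot 1) ((p, tt), (q, tt)) =
  (cop C n : shom C V V) (p, q).
Proof.
rewrite -sapp_pure1 [sapp _ _](Psi_dot hPsi [tuple lett q] isT) big_ord1 take0.
rewrite [LHS]ffunE -[set_nth _ _ _ _]/[:: bar (lett q)] pure1E gl_opE ffunE /= mul1r.
rewrite -(can_eq (@lettK n)) monoK; case: (lett p =P _) => _; last exact: mulr0.
exact: mulr1.
Qed.

Lemma web_image_cop k i : (i < k)%N -> web_image (site k i (cop C n)).
Proof.
elim: k i => [|k IH] [|i] //= ik; last exact: web_image_shift (IH _ _).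
have td : typed [:: 1%N] [:: 1%N] (Tdot 1 : term C) by constructor.
have ti : typed (nseq k 1%N) (nseq k 1%N) (Tid (nseq k 1%N) : term C).
  exact/ty_id/wobj_ones.
exists (Ttens (Tdot 1) (Tid (nseq k 1%N))); first exact: (ty_tens td ti).
rewrite -(stenso_head k Psi_dot1) -(@fmap_id _ _ Psi) ?wobj_ones //.
exact: (fmap_tens Psi td ti).
Qed.

Lemma pure2E (l1 l2 : letter n) p1 p2 :
  pure C [:: 1%N; 1%N] [:: [:: l1]; [:: l2]] (p1, (p2, tt))
  = (p1 == mono l1)%:R * (p2 == mono l2)%:R.
Proof.
rewrite [LHS]ffunE /= [X in _ * X]ffunE /= [X in _ * (_ * X)]ffunE mulr1.
by rewrite !symw1E -!(can_eq (@lettK n)) !monoK.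
Qed.

#[local] Arguments pure : simpl never.

Lemma sapp_pure2 a (f : shom C (Sob n [:: 1%N; 1%N]) (Sob n a)) (q1 q2 : V) p :
  sapp f (pure C [:: 1%N; 1%N] [:: [:: lett q1]; [:: lett q2]]) p
  = f (p, (q1, (q2, tt))).
Proof.
rewrite ffunE (bigD1 ((q1, (q2, tt)) : Sob n [:: 1%N; 1%N])) //= big1.
  by rewrite pure2E !lettK !eqxx !mulr1 addr0.
move=> [q1' [q2' []]] qq'; rewrite pure2E !lettK.
case: (q1' =P q1) => [E1|]; last by rewrite mul0r mulr0.
case: (q2' =P q2) => [E2|]; last by rewrite !mulr0.
by rewrite E1 E2 eqxx in qq'.
Qed.

Lemma sapp_comp (M N P : superspace) (g : shom C N P) (f : shom C M N) v :
  sapp (scomp g f) v = sapp g (sapp f v).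
Proof.
apply/ffunP => p; rewrite !ffunE.
under [RHS]eq_bigr => y _ do rewrite ffunE mulr_sumr.
rewrite exchange_big; apply: eq_bigr => x _ /=.
by rewrite scompE mulr_suml; apply: eq_bigr => y _; rewrite mulrA.
Qed.

(** On two thin strands, split after merge is the identity plus the superflip. *)
Definition crossing : term C :=
  Tadd (Tcomp (Tsplit 1 1) (Tmerge 1 1)) (Tscale (-1) (Tid [:: 1%N; 1%N])).

Lemma typed_crossing : typed [:: 1%N; 1%N] [:: 1%N; 1%N] crossing.
Proof.
apply: ty_add; last by apply: ty_scale; apply: ty_id.
by apply: (@ty_comp _ _ [:: 2]); [apply: (@ty_split _ 1 1) | apply: (@ty_merge _ 1 1)].
Qed.

Lemma Psi_crossing p1 p2 q1 q2 :
  Psi [:: 1%N; 1%N] [:: 1%N; 1%N] crossing ((p1, (p2, tt)), (q1, (q2, tt)))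
  = ((p1 == q2) && (p2 == q1))%:R * (-1) ^+ (spar (q1 : V) && spar (q2 : V)).
Proof.
have tm : typed [:: 1%N; 1%N] [:: 2] (Tmerge 1 1 : term C) by apply: (@ty_merge _ 1 1).
have ts : typed [:: 2] [:: 1%N; 1%N] (Tsplit 1 1 : term C) by apply: (@ty_split _ 1 1).
have ti : typed [:: 1%N; 1%N] [:: 1%N; 1%N] (Tid [:: 1%N; 1%N] : term C).
  by apply: ty_id.
rewrite /crossing fmap_add; [|exact: ty_comp ts tm|exact: ty_scale].
rewrite fmap_scale // fmap_id // (fmap_comp _ ts tm).
rewrite addsE scalesE sidE -sapp_pure2 sapp_comp.
rewrite [sapp (Psi _ _ (Tmerge 1 1)) _]
  (Psi_merge hPsi [tuple lett q1] [tuple lett q2] isT isT).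
rewrite [sapp _ _](Psi_split hPsi (k := 1) (l := 1) [tuple lett q1; lett q2] isT isT).
(* The two one-element subsets: the first gives the identity, cancelled by the subtracted term, the
   second gives the flip with its sign. *)
rewrite (bigD1 [tuple true; false]) //= (bigD1 [tuple false; true]) //= big1.
  have DE (v w : svec C (Sob n [:: 1%N; 1%N])) m : (v + w) m = v m + w m.
    by rewrite ffunE.
  have ZE z (v : svec C (Sob n [:: 1%N; 1%N])) m : (z *: v) m = z * v m.
    by rewrite ffunE.
  rewrite addr0 DE !ZE !pure2E !lettK.
  have -> : shuffle_inv [tuple true; false] [tuple lett q1; lett q2] = 0%N.
    by rewrite /shuffle_inv !big_ord_recl !big_ord0.
  have -> : shuffle_inv [tuple false; true] [tuple lett q1; lett q2]
      = (lett q1).2 && (lett q2).2 :> nat.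
    rewrite /shuffle_inv !big_ord_recl !big_ord0 /=.
    by rewrite !addn0.
  have -> : ((p1, (p2, tt)) == (q1, (q2, tt)) :> Sob n [:: 1%N; 1%N])
      = (p1 == q1) && (p2 == q2) by rewrite !xpair_eqE andbT.
  rewrite expr0 mul1r -!mulnb !natrM mulN1r addrAC subrr add0r mulrC.
  by rewrite -!spar_mon1.
move=> I /andP[/andP[cI I1] I2]; exfalso.
case/tupleP: I cI I1 I2 => x I; case/tupleP: I => y I.
by rewrite (tuple0 I); case: x; case: y.
Qed.

Lemma web_image_swap k j : (j.+1 < k)%N -> web_image (swap C n k j).
Proof.
elim: k j => [|[|k] IH] [|j] // jk; last exact: web_image_shift (IH _ _).
have ti : typed (nseq k 1%N) (nseq k 1%N) (Tid (nseq k 1%N) : term C).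
  exact/ty_id/wobj_ones.
exists (Ttens crossing (Tid (nseq k 1%N))); first exact: (ty_tens typed_crossing ti).
rewrite [RHS]/= -(stenso_swap k Psi_crossing) -(@fmap_id _ _ Psi) ?wobj_ones //.
exact: (fmap_tens Psi typed_crossing ti).
Qed.

Let G k : opW k := parity_op C (W k).

(* Multiplying the odd webs by the parity operator turns supercommutation
   into commutation. *)
Definition web_image_parity k (X : opW k) : Prop :=
  exists X0 X1 : opW k,
  [/\ web_image X0, web_image X1, homog false (X0 : shom C _ _),
      homog true (X1 : shom C _ _) & X = X0 + X1 * G k].

Lemma homog0 e M N : homog e (0 : shom C M N).
Proof. by apply/homogP => p q _; rewrite ffunE. Qed.

Lemma web_image0 k : web_image (0 : opW k).
Proof. rewrite -(scale0r (1 : opW k)); exact/web_imageZ/web_image1. Qed.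

Lemma web_image_parity_even k (X : opW k) :
  web_image X -> homog false (X : shom C _ _) -> web_image_parity X.
Proof.
move=> iX hX; exists X, 0; split=> //; [exact: web_image0|exact: homog0|].
by rewrite mul0r addr0.
Qed.

Lemma web_image_parity_odd k (X : opW k) :
  web_image X -> homog true (X : shom C _ _) -> web_image_parity (X * G k).
Proof.
move=> iX hX; exists 0, X; split=> //; [exact: web_image0|exact: homog0|].
by rewrite add0r.
Qed.

Lemma web_image_parityD k (X Y : opW k) :
  web_image_parity X -> web_image_parity Y -> web_image_parity (X + Y).
Proof.
move=> [X0 [X1 [? ? ? ? ->]]] [Y0 [Y1 [? ? ? ? ->]]].
exists (X0 + Y0), (X1 + Y1); split; try exact: web_imageD; try exact: homogD.
by rewrite mulrDl addrACA.
Qed.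

Lemma web_image_parityZ k a (X : opW k) :
  web_image_parity X -> web_image_parity (a *: X).
Proof.
move=> [X0 [X1 [? ? ? ? ->]]].
exists (a *: X0), (a *: X1); split; try exact: web_imageZ; try exact: homogZ.
by rewrite scalerDr opZl.
Qed.

Lemma web_image_parityM k (X Y : opW k) :
  web_image_parity X -> web_image_parity Y -> web_image_parity (X * Y).
Proof.
move=> [X0 [X1 [iX0 iX1 hX0 hX1 ->]]] [Y0 [Y1 [iY0 iY1 hY0 hY1 ->]]].
(* The -1 comes from moving [G] past the odd [Y1]; then [G] squares to 1. *)
exists (X0 * Y0 + -1 *: (X1 * Y1)), (X0 * Y1 + X1 * Y0); split.
- by apply: web_imageD; [|apply: web_imageZ]; apply: web_imageM.
- by apply: web_imageD; apply: web_imageM.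
- apply: homogD; first exact: (homogM hX0 hY0).
  apply: homogZ; exact: (homogM hX1 hY1).
- by apply: homogD; [exact: (homogM hX0 hY1) | exact: (homogM hX1 hY0)].
have GY0 : G k * Y0 = Y0 * G k by rewrite (parity_op_comm hY0) scale1r.
have GY1 : G k * Y1 = - (Y1 * G k) by rewrite (parity_op_comm hY1) scaleN1r.
have -> : (X0 + X1 * G k) * (Y0 + Y1 * G k)
    = X0 * Y0 + X0 * Y1 * G k + (X1 * Y0 * G k - X1 * Y1).
  rewrite mulrDl !mulrDr -!mulrA GY0 (mulrA (G k) Y1) GY1; congr (_ + (_ + _)).
  by rewrite mulNr -mulrA parity_op2 mulr1 mulrN.
by rewrite scaleN1r mulrDl (addrC (X1 * Y0 * G k)) addrACA.
Qed.

Lemma q_hom_comm e k (f : opW k) e' (x : opV) :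
  qhom (f : shom C (W k) (W k)) -> homog e (f : shom C _ _) ->
  supercommutes (cop C n) e' x ->
  f * (\sum_(i < k) site k i x)
  = (-1) ^+ (e && e') *: ((\sum_(i < k) site k i x) * f).
Proof.
move=> qf hf sx; have := qf e e' _ (op_gl_q_mem sx) (homog_op_gl sx.1).
by rewrite hf !act_sites op_glK -!opM.
Qed.

Lemma web_image_even k (f : opW k) : homog false (f : shom C _ _) ->
  (forall e x, supercommutes (cop C n) e x ->
    f * (\sum_(i < k) site k i x) = (\sum_(i < k) site k i x) * f) ->
  web_image f.
Proof.
move=> hf fc.
have [X0 [X1 [iX0 _ hX0 hX1 E]]] : web_image_parity f.
  apply: (double_commutant_sergeev (cop_odd C n) (cop2 C n) _ _ _ _ _ _ fc).
  - by apply: web_image_parity_even; [apply: web_image1 | apply: homog_id].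
  - exact: web_image_parityD.
  - exact: web_image_parityZ.
  - exact: web_image_parityM.
  - move=> i ik; apply: web_image_parity_odd; first exact: web_image_cop.
    by apply: site_homog; apply: cop_odd.
  - move=> j jk; apply: web_image_parity_even; first exact: web_image_swap.
    exact: swap_homog.
(* [X1 * G k] is odd, being a product of an odd and an even operator, and even, being [f - X0]; so
   it vanishes. *)
suff -> : f = X0 by [].
have /eqP : X1 * G k = 0.
  apply: homog_inter; last exact: (homogM hX1 (homog_parity_op C (W k))).
  have -> : X1 * G k = f + -1 *: X0 by rewrite E scaleN1r addrAC subrr add0r.
  by apply: homogD => //; apply: homogZ.
by move=> /eqP X1G; rewrite E X1G addr0.
Qed.

Lemma web_image_homog e k (f : opW k) : qhom (f : shom C (W k) (W k)) ->
  homog e (f : shom C _ _) -> web_image f.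
Proof.
move=> qf hf; case: e hf => hf; last first.
  apply: web_image_even => // e x sx.
  by rewrite (q_hom_comm qf hf sx) scale1r.
(* Without strands there is no dot to compose with, but the unit object is purely even and has no
   nonzero odd endomorphism. *)
case: k => [|k] in f qf hf *.
  suff -> : f = 0 by apply: web_image0.
  by apply: shomP => -[] []; rewrite [RHS]ffunE; apply: ((homogP _ _).1 hf).
pose c0 := site k.+1 0 (cop C n).
have ic : web_image c0 by apply: web_image_cop.
have c0_odd : homog true (c0 : shom C _ _) by apply: site_homog; apply: cop_odd.
have -> : f = f * c0 * c0 by rewrite -mulrA -siteM cop2 site1 // mulr1.
apply: web_imageM => //; apply: web_image_even; first exact: (homogM hf c0_odd).
move=> e x sx; rewrite -mulrA.
(* At site 0 this is supercommutation of [x] with [cop], elsewhere that of distinct sites. The sign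
   cancels the one due to the odd [f]. *)
have -> : c0 * (\sum_(i < k.+1) site k.+1 i x)
    = (-1) ^+ e *: ((\sum_(i < k.+1) site k.+1 i x) * c0).
  rewrite mulr_sumr mulr_suml scaler_sumr; apply: eq_bigr => i _.
  have [i0 | i0] := posnP i; last first.
    by rewrite (site_comm _ (cop_odd C n) sx.1) // neq_ltn i0.
  by rewrite i0 -!siteM sx.2 siteZ.
by rewrite opZr mulrA (q_hom_comm qf hf sx) opZl signZK mulrA.
Qed.

Lemma qhom_hpart e a b (f : shom C (Sob n a) (Sob n b)) : qhom f -> qhom (hpart e f).
Proof.
move=> qf e1 e' x qx hx; have := qf e1 e' x qx hx.
rewrite (hpart_homog e1 (homog_hpart e f)); case: (e =P e1) => [-> // | _ _].
by rewrite scomp0l scomp0r scaler0.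
Qed.

Lemma web_image_qhom k (f : opW k) : qhom (f : shom C (W k) (W k)) -> web_image f.
Proof.
move=> qf; rewrite (hpartD (f : shom C _ _)).
by apply: web_imageD; apply: web_image_homog (homog_hpart _ _); apply: qhom_hpart.
Qed.

Lemma qhom_even_comp a b c d (g : shom C (Sob n c) (Sob n d))
    (f : shom C (Sob n b) (Sob n c)) (h : shom C (Sob n a) (Sob n b)) :
  homog false g -> homog false h -> qhom g -> qhom f -> qhom h ->
  qhom (scomp g (scomp f h)).
Proof.
move=> hg hh qg qf qh e e' x qx hx; rewrite hpart_sandwich //.
have := qg false e' x qx hx; rewrite hg scale1r => Eg.
have := qh false e' x qx hx; rewrite hh scale1r => Eh.
rewrite -!scompA Eh (scompA (hpart e f)) (qf e e' x qx hx).
by rewrite scompZl scompZr -!scompA (scompA g) Eg !scompA.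
Qed.

(* The identity of V_n belongs to q(n) and acts by k on the k-fold tensors. *)
Lemma qhom_degree k l (f : shom C (W k) (W l)) : qhom f -> k <> l -> f = 0.
Proof.
move=> qf kl.
have s1 : supercommutes (cop C n) false 1.
  by split; [apply: homog_id | rewrite mulr1 mul1r scale1r].
have deg m : Defs.act (nseq m 1%N) (op_gl (1 : opV)) = m%:R *: sid C (W m).
  rewrite act_sites op_glK (eq_bigr (fun=> 1 : opW m)) => [|i _]; last first.
    by rewrite site1.
  by rewrite sumr_const card_ord scaler_nat.
have f0 e : hpart e f = 0.
  have := qf e false _ (op_gl_q_mem s1) (homog_op_gl s1.1).
  rewrite !deg scompZr scompZl scomp1l scomp1r andbF scale1r => /eqP.
  rewrite -subr_eq0 -scalerBl scaler_eq0 subr_eq0 eqr_nat.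
  by case/orP => [/eqP // | /eqP].
by rewrite (hpartD f) !f0 addr0.
Qed.

Theorem superfunctor_full : full_functor Psi.
Proof.
move=> a b wa wb f qf.
have [t [u [N N0 [tt0 tu pt pu E]]]] := retract_ones Psi wa.
have [t' [u' [N' N'0 [tt1 tu1 pt' pu' E']]]] := retract_ones Psi wb.
set A := sumn a in t tt0 pt u tu pu E *; set B := sumn b in t' tt1 pt' u' tu1 pu' E' *.
(* Compression of [f] to thin strands; undoing it multiplies [f] by [N * N']. *)
pose g := scomp (Psi b (nseq B 1%N) u') (scomp f (Psi (nseq A 1%N) a t)).
have qg : qhom g.
  apply: qhom_even_comp => //; try exact: fmap_qhom.
    exact: fmap_par pu'.
  exact: fmap_par pt.
have Ef : f = (N * N')^-1 *: scomp (Psi (nseq B 1%N) b t') (scomp g (Psi a (nseq A 1%N) u)).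
  rewrite /g -!scompA E !scompA E' scompZl scomp1l scompZr scomp1r scalerA.
  by rewrite scalerA mulVf ?scale1r // mulf_neq0.
have [AB | /eqP AB] := eqVneq A B; last first.
  (* With the factor 0, [fmap_scale] gives the image directly, whatever the image of [Tzero]. *)
  exists (Tscale 0 (Tzero a b)); first by apply: ty_scale; apply: ty_zero.
  rewrite fmap_scale; last exact: ty_zero.
  by rewrite Ef (qhom_degree qg AB) scomp0l scomp0r scale0r scaler0.
clearbody A B; subst B.
have [s ts Es] := web_image_qhom qg.
exists (Tscale (N * N')^-1 (Tcomp t' (Tcomp s u))).
  by apply: ty_scale; apply: ty_comp tt1 (ty_comp ts tu).
rewrite fmap_scale; last exact: ty_comp tt1 (ty_comp ts tu).
by rewrite (fmap_comp _ tt1 (ty_comp ts tu)) (fmap_comp _ ts tu) Es -Ef.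
Qed.

End Fullness.

Local Open Scope complex_scope.

Theorem theorem5p4p1 (R : realType) (n : nat) (hn : (1 <= n)%N)
    (Psi : superfunctor R[i] n) (hPsi : is_Psi Psi) :
  full_functor Psi.
Proof. exact: superfunctor_full. Qed.
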